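(* Let $n\ge2$ and $1\le q<p<q^*$, where $q^*=\frac{qn}{n-q}$ if $1\le q<n$ and $q^*=\infty$ if $q\ge n$. Let $\Omega\subset\mathbb{R}^n$ be a bounded Sobolev $(p,q)$-extension domain. Then there exist $\delta>0$ and an exponent $s\ge n$, with $s=s(p,q)$ depending only on $p$ and $q$ (and on the dimension $n$), such that $$|B(x,r)\cap\Omega|\ge\delta r^s$$ for every $x\in\partial\Omega$ and all $0<r\le\frac{\operatorname{diam}(\Omega)}{6}$. Moreover, when $q<n$, one may choose $s=\dfrac{1}{\frac1p-\frac1{q^*}}$.
   Context: $|\cdot|$ denotes $n$-dimensional Lebesgue measure and $B(x,r)$ the open ball in $\mathbb{R}^n$ with center $x$ and radius $r$. A domain is a nonempty connected open set. For an open set $G\subset\mathbb{R}^n$ and $1\le p<\infty$, $W^{1,p}(G)$ is the space of weakly differentiable $u\in L^p(G)$ with weak gradient $\nabla u\in L^p(G;\mathbb{R}^n)$, with norm $\|u\|_{W^{1,p}(G)}=\left(\int_G |u|^p+|\nabla u|^p\,dx\right)^{1/p}$. For $1\le q\le p<\infty$ and $n\ge2$, a bounded domain $\Omega\subset\mathbb{R}^n$ is a Sobolev $(p,q)$-extension domain if there exist a map $E:W^{1,p}(\Omega)\to W^{1,q}(\mathbb{R}^n)$ (not required to be linear) and a constant $C>0$ such that $Eu|_\Omega=u$ and $\|Eu\|_{W^{1,q}(\mathbb{R}^n)}\le C\|u\|_{W^{1,p}(\Omega)}$ for every $u\in W^{1,p}(\Omega)$. *)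

(* Defs.v *)
From HB Require Import structures.
From mathcomp Require Import all_boot all_order all_algebra.
From mathcomp Require Import all_classical all_reals all_analysis.

Set Implicit Arguments.
Unset Strict Implicit.
Unset Printing Implicit Defensive.
Import Order.TTheory GRing.Theory Num.Theory.
Import numFieldNormedType.Exports.

Local Open Scope classical_set_scope.
Local Open Scope ring_scope.

(* R^n is 'rV[R]_n. The library's norm and metric on it are those of the       *)
(* maximum norm: they give the usual topology and the usual bounded sets, but  *)
(* Euclidean balls, lengths and diameters have to be introduced separately.    *)

(* The sigma-algebra generated by the coordinate functions is the Borel one. *)
Definition rV_display : measure_display.
Proof. exact: default_measure_display. Qed.

Section measurable_rV.
Context {R : realType} (n : nat).

Let coord (i : 'I_n) (v : 'rV[R]_n) : R := v ord0 i.

HB.instance Definition _ := @isMeasurable.Build rV_display 'rV[R]_n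
  (g_sigma_preimage coord) (@sigma_algebra0 _ _ _)
  (@sigma_algebraC _ _) (@sigma_algebra_bigcup _ _ _).

End measurable_rV.

Section lebesgue_rV.
Context {R : realType}.

Lemma measurable_coord n (i : 'I_n) :
  measurable_fun [set: 'rV[R]_n] (fun v : 'rV[R]_n => v ord0 i).
Proof.
move=> _ Y mY; rewrite setTI; apply: sub_sigma_algebra => /=.
rewrite -bigcup_seq/=; exists i => /=; first by rewrite mem_index_enum.
by exists Y => //; rewrite setTI.
Qed.

Lemma measurable_fun_rV d (T : measurableType d) n (f : T -> 'rV[R]_n) :
  (forall i, measurable_fun [set: T] (fun t => f t ord0 i)) ->
  measurable_fun [set: T] f.
Proof.
move=> mf; apply: (@measurability _ _ _ _ _ _
  (\big[setU/set0]_(i < n) preimage_set_system setT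
     (fun v : 'rV[R]_n => v ord0 i) measurable)) => //.
move=> _ [A + <-]; rewrite -bigcup_seq => -[i _ [B mB <-]].
by have := mf i measurableT _ mB; rewrite !setTI.
Qed.

Definition rV_cons n (a : measurableTypeR R * 'rV[R]_n) : 'rV[R]_n.+1 :=
  \row_i (if unlift ord0 i is Some j then a.2 ord0 j else a.1).

Definition rV_uncons n (v : 'rV[R]_n.+1) : measurableTypeR R * 'rV[R]_n :=
  (v ord0 ord0, \row_j v ord0 (lift ord0 j)).

Lemma rV_unconsK n : cancel (@rV_uncons n) (@rV_cons n).
Proof.
by move=> v; apply/rowP => i; rewrite mxE/=; case: unliftP => [j ->|->];
  rewrite ?mxE.
Qed.

Lemma rV_consK n : cancel (@rV_cons n) (@rV_uncons n).
Proof.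
move=> [a v]; rewrite /rV_uncons !mxE unlift_none/=; congr pair.
by apply/rowP => j; rewrite !mxE liftK.
Qed.

Lemma measurable_rV_cons n : measurable_fun setT (@rV_cons n).
Proof.
apply: measurable_fun_rV => i; case: (unliftP ord0 i) => [j ->|->].
  under eq_fun do rewrite mxE liftK.
  by apply: (@measurableT_comp _ _ _ _ _ _ (fun v : 'rV[R]_n => v ord0 j));
    [exact: measurable_coord|exact: measurable_snd].
by under eq_fun do rewrite mxE unlift_none; exact: measurable_fst.
Qed.

Lemma measurable_rV_uncons n : measurable_fun setT (@rV_uncons n).
Proof.
apply/measurable_fun_pairP; split; first exact: measurable_coord.
apply: measurable_fun_rV => i /=.
by under eq_fun do rewrite mxE; exact: measurable_coord.
Qed.

Section step.
Local Open Scope ereal_scope.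
Context n (mu : {sigma_finite_measure set 'rV[R]_n -> \bar R}).

HB.instance Definition _ := isMeasurableFun.Build _ _ _ _ (@rV_cons n)
  (@measurable_rV_cons n).

Definition lebesgue_step : set 'rV[R]_n.+1 -> \bar R :=
  pushforward (@lebesgue_measure R \x mu) (@rV_cons n).

Let lebesgue_step0 : lebesgue_step set0 = 0.
Proof. exact: measure0. Qed.

Let lebesgue_step_ge0 A : 0 <= lebesgue_step A.
Proof. exact: measure_ge0. Qed.

Let lebesgue_step_sigma_additive : semi_sigma_additive lebesgue_step.
Proof. exact: measure_semi_sigma_additive. Qed.

HB.instance Definition _ := isMeasure.Build _ _ _ lebesgue_step
  lebesgue_step0 lebesgue_step_ge0 lebesgue_step_sigma_additive.

Let lebesgue_step_sigma_finite : sigma_finite setT lebesgue_step.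
Proof.
have /sigma_finiteP[F [FT ndF Foo]] := sigma_finiteT (@lebesgue_measure R).
have /sigma_finiteP[G [GT ndG Goo]] := sigma_finiteT mu.
exists (fun k => @rV_uncons n @^-1` (F k `*` G k)).
  apply/esym; rewrite -subTset => v _.
  have [i _ Fi] : (\bigcup_i F i) (rV_uncons v).1 by rewrite -FT.
  have [j _ Gj] : (\bigcup_i G i) (rV_uncons v).2 by rewrite -GT.
  exists (maxn i j) => //; split.
    by move: Fi; exact/subsetPset/ndF/leq_maxl.
  by move: Gj; exact/subsetPset/ndG/leq_maxr.
move=> k; have [mF Fk] := Foo k; have [mG Gk] := Goo k; split.
  rewrite -[X in measurable X]setTI; apply: measurable_rV_uncons => //.
  exact: measurableX.
rewrite /lebesgue_step /pushforward -comp_preimage.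
rewrite (_ : _ \o _ = id) ?preimage_id; last first.
  by apply/funext => a; exact: rV_consK.
by rewrite product_measure1E// lte_mul_pinfty// ge0_fin_numE.
Qed.

HB.instance Definition _ := Measure_isSigmaFinite.Build _ _ _ lebesgue_step
  lebesgue_step_sigma_finite.

End step.

(* n-dimensional Lebesgue measure on the Borel sets, as an iterated product.    *)
Fixpoint lebesgue_rV n : {sigma_finite_measure set 'rV[R]_n -> \bar R} :=
  if n is m.+1 then lebesgue_step (lebesgue_rV m) else dirac (0 : 'rV[R]_0).

End lebesgue_rV.

Section euclidean.
Context {R : realType} {n : nat}.
Implicit Types (x y : 'rV[R]_n) (A : set 'rV[R]_n).

Definition euclidean_norm x : R := Num.sqrt (\sum_i x ord0 i ^+ 2).

Definition euclidean_ball x (r : R) : set 'rV[R]_n :=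
  [set y | euclidean_norm (y - x) < r].

(* The supremum is meaningful for nonempty bounded sets. *)
Definition diameter A : R :=
  sup [set euclidean_norm (x - y) | x in A & y in A].

Definition boundary A : set 'rV[R]_n := closure A `\` interior A.

Definition domain A : Prop := [/\ A !=set0, open A & connected A].

End euclidean.

Section sobolev.
Context {R : realType} {n : nat}.
Implicit Types (G : set 'rV[R]_n) (p q : R) (u phi : 'rV[R]_n -> R).
Implicit Types (g : 'rV[R]_n -> 'rV[R]_n).

Local Notation mu := (@lebesgue_rV R n).

Definition partial (i : 'I_n) u : 'rV[R]_n -> R :=
  fun x => 'D_(delta_mx ord0 i) u x.

Definition smooth u : Prop := forall s : seq 'I_n,
  let v := foldr partial u s in
  continuous v /\ forall (i : 'I_n) x, derivable v x (delta_mx ord0 i).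

(* C_c^oo(G) *)
Definition test_function G phi : Prop :=
  let K := closure [set x | phi x != 0] in
  [/\ smooth phi, compact K & K `<=` G].

Definition locally_integrable_rV G u : Prop :=
  measurable_fun G u /\
  forall K, compact K -> K `<=` G -> (\int[mu]_(x in K) `|u x|%:E < +oo)%E.

Definition is_weak_gradient G u g : Prop :=
  forall i : 'I_n, locally_integrable_rV G (fun x => g x ord0 i) /\
  forall phi, test_function G phi ->
    \int[mu]_(x in G) (u x * partial i phi x) =
    - \int[mu]_(x in G) (g x ord0 i * phi x).

Definition weakly_differentiable G u : Prop :=
  locally_integrable_rV G u /\ exists g, is_weak_gradient G u g.

(* A weak gradient is unique only almost everywhere on G: this picks one. *)
Definition weak_gradient G u : 'rV[R]_n -> 'rV[R]_n :=
  xget (fun=> 0) [set g | is_weak_gradient G u g].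

Definition in_Lp G p u : Prop :=
  measurable_fun G u /\ (\int[mu]_(x in G) (`|u x| `^ p)%:E < +oo)%E.

(* The components of the weak gradient are measurable on G by definition, so   *)
(* that it is in L^p(G; R^n) if and only if its length is in L^p(G).           *)
Definition sobolev G p u : Prop :=
  [/\ in_Lp G p u, weakly_differentiable G u &
      in_Lp G p (euclidean_norm \o weak_gradient G u)].

Definition sobolev_norm G p u : \bar R :=
  ((\int[mu]_(x in G)
      (`|u x| `^ p + euclidean_norm (weak_gradient G u x) `^ p)%:E) `^ p^-1)%E.

Definition ae_eq_on G u v : Prop := {ae mu, forall x, G x -> u x = v x}.

(* Elements of Sobolev spaces are represented by functions on the whole of     *)
(* R^n whose values outside of the open set are ignored. The first condition   *)
(* on E says that it is a map between classes of functions modulo a.e.         *)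
(* equality.                                                                   *)
Definition sobolev_extension_domain p q (Omega : set 'rV[R]_n) : Prop :=
  [/\ domain Omega, bounded_set Omega &
    exists E : ('rV[R]_n -> R) -> ('rV[R]_n -> R),
    exists2 C : R, 0 < C &
      (forall u v, sobolev Omega p u -> sobolev Omega p v ->
         ae_eq_on Omega u v -> ae_eq_on setT (E u) (E v)) /\
      forall u, sobolev Omega p u ->
        [/\ sobolev setT q (E u), ae_eq_on Omega (E u) u &
            (sobolev_norm setT q (E u) <= C%:E * sobolev_norm Omega p u)%E]].

End sobolev.

Definition sobolev_conjugate {R : realType} (n : nat) (q : R) : \bar R :=
  if q < n%:R then (q * n%:R / (n%:R - q))%:E else +oo%E.

(* Main.v *)
Require Import Defs.
From mathcomp Require Import all_boot all_order all_algebra.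
From mathcomp Require Import ring lra.
From mathcomp Require Import all_classical all_reals all_analysis.
From mathcomp Require Import measurable_realfun.
From mathcomp Require Import zify.

(* Let phi(r) = |B(x,r) /\ Omega|. A smooth cut-off equal to 1 on B(x,rho) and
   to 0 off B(x,r) extends to some v in W^{1,q}(R^n) that is 1 a.e. on the open
   set A = B(x,rho) /\ Omega. A weak-type Sobolev inequality |A| <= C ||v||^t,
   with t = q* if q < n and any t > p otherwise, then gives
   phi(rho) <= M phi(r)^(t/p) (r - rho)^(-t). If phi(r) were smaller than
   delta r^s, iterating this along radii decreasing to r/2 would force
   phi(r/2) = 0, which is impossible at a boundary point.
   For the weak-type inequality, let v_k be the mollification of v at scale
   2^-k. For y in A one has v_k(y) = 1 for large k, because A is open, so some
   increment v_{k+1}(y) - v_k(y) exceeds a prescribed threshold unless v_0(y) is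
   large. The increment is an integral of grad v against a kernel of size
   2^{k(n-1)} supported in a cube of side 4 2^-k around y. A convexity bound
   excludes large increments at the coarse scales k <= K, and Fubini's theorem
   bounds the measure of the set of y with a large increment at the scales
   k > K. *)

Set Implicit Arguments.
Unset Strict Implicit.
Unset Printing Implicit Defensive.
Import Order.TTheory GRing.Theory Num.Theory.
Import numFieldNormedType.Exports.
Local Open Scope classical_set_scope.
Local Open Scope ring_scope.

(** * Boxes and Lebesgue measure on row vectors *)

(** The extension controls the full norm with exponent q, which is not homogeneous, so the
    inequality for v is stated in terms of the energy N, the integral of |v|^q + |grad v|^q. It
    reads |A| <= C N^sigma with sigma = t/q. Put beta = 1/(sigma - 1); for q < n the condition t <=
    q* becomes n - q <= beta q. A large increment at scale k forces an energy of order 2^(-k(n-q))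
    >= 2^(-beta q k) in a single cube. This is impossible for k <= K if 2^(-beta q K) is a suitable
    multiple of N, and the exceptional sets for k > K have total measure of order N 2^(-qK), that is
    N^(1 + 1/beta) = N^sigma. The thresholds need a sum bounded independently of K, hence geometric
    decay on both sides of K, slow enough not to spoil these two estimates. When N is not small, |A|
    <= N suffices. All kernels are products of one-variable functions from a class closed under
    differentiation. Smoothness, supports and integrals thus become questions on the line, and the
    gradient of v enters through its defining integration by parts, without differentiating a
    convolution. *)

Definition box {R : realType} n (a b : 'rV[R]_n) : set 'rV[R]_n :=
  [set z | forall i, a ord0 i < z ord0 i < b ord0 i].

Definition cbox {R : realType} n (a b : 'rV[R]_n) : set 'rV[R]_n :=
  [set z | forall i, a ord0 i <= z ord0 i <= b ord0 i].

Section box.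
Context {R : realType} {n : nat}.
Implicit Types (a b x y z : 'rV[R]_n).

Lemma boxE a b : box a b =
  \big[setI/setT]_(i < n)
    ((fun v : 'rV[R]_n => v ord0 i) @^-1` `]a ord0 i, b ord0 i[).
Proof.
rewrite -bigcap_seq; apply/seteqP; split=> [z zab i _ /=|z zab i].
  by rewrite in_itv/= zab.
by have := zab i (mem_index_enum i); rewrite /= in_itv.
Qed.

Lemma measurable_box a b : measurable (box a b).
Proof.
rewrite boxE; apply: bigsetI_measurable => i _; rewrite -[X in measurable X]setTI.
exact: measurable_coord.
Qed.

Lemma boxI a b c d : box a b `&` box c d =
  box (\row_i Num.max (a ord0 i) (c ord0 i)) (\row_i Num.min (b ord0 i) (d ord0 i)).
Proof.
apply/seteqP; split=> z /=.
  move=> [ab cd] i; rewrite !mxE gt_max lt_min.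
  by have /andP[-> ->] := ab i; have /andP[-> ->] := cd i.
move=> h; split=> i; have := h i; rewrite !mxE gt_max lt_min;
  by move=> /andP[/andP[? ?] /andP[? ?]]; apply/andP.
Qed.

Lemma rV_ballP x e y : 0 < e ->
  ball x e y <-> forall i, `|x ord0 i - y ord0 i| < e.
Proof.
move=> e0; split=> [[_ h] i|h]; first by have := h ord0 i.
by split=> // i j; rewrite (ord1 i); exact: h.
Qed.

Lemma rV_ballE x e : 0 < e -> ball x e = box (x - const_mx e) (x + const_mx e).
Proof.
move=> e0; apply/seteqP; split=> y.
  move=> /(rV_ballP _ _ e0) h i; rewrite !mxE.
  by have := h i; rewrite distrC ltr_distl.
move=> h; apply/(rV_ballP _ _ e0) => i; have := h i; rewrite !mxE.
by rewrite distrC ltr_distl.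
Qed.

(* Rational balls of radius 1/(k+1), indexed by nat; D selects those whose
   closure lies in A. *)
Lemma open_box_cover (A : set 'rV[R]_n) : open A ->
  exists (D : set nat) (l r : nat -> 'rV[R]_n),
    (forall k, D k -> cbox (l k) (r k) `<=` A) /\
    A = \bigcup_(k in D) box (l k) (r k).
Proof.
move=> oA.
pose c k : 'rV[R]_n := if @unpickle ('rV[rat]_n * nat)%type k is Some qm
  then \row_i ratr (qm.1 ord0 i) else 0.
pose e k : R := if @unpickle ('rV[rat]_n * nat)%type k is Some qm
  then qm.2.+1%:R^-1 else 1.
pose l k := c k - const_mx (e k); pose r k := c k + const_mx (e k).
exists [set k | cbox (l k) (r k) `<=` A], l, r; split=> //.
apply/seteqP; split=> [x Ax|x [k /= kA xk]]; last first.
  by apply: kA => i; have /andP[? ?] := xk i; rewrite !ltW.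
have /nbhs_ballP[d /= d0 xd] := open_nbhs_nbhs (conj oA Ax).
(* Half of d: the rational centre is within 1/(m+1) of x, and the closed box extends by another
   1/(m+1). *)
have [m md] : exists m : nat, m.+1%:R^-1 < d / 2.
  have [m md] := ltr_add_invr (divr_gt0 d0 (ltr0n _ 2)).
  by exists m; move: md; rewrite add0r.
have mi0 : 0 < m.+1%:R^-1 :> R by rewrite invr_gt0.
have /choice[q xq] : forall i : 'I_n, exists q : rat,
    `|x ord0 i - ratr q| < m.+1%:R^-1.
  move=> i; have : x ord0 i - m.+1%:R^-1 < x ord0 i + m.+1%:R^-1
    by rewrite ltrBlDr -addrA ltrDl addr_gt0.
  move=> /rat_in_itvoo[q]; rewrite in_itv/= => hq; exists q.
  by rewrite distrC ltr_distl.
pose k := pickle ((\row_i q i : 'rV[rat]_n), m).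
have ck i : c k ord0 i = ratr (q i) by rewrite /c /k pickleK !mxE.
have ek : e k = m.+1%:R^-1 by rewrite /e /k pickleK.
exists k => /= [y yk|i]; last by rewrite !mxE ck ek -ltr_distl.
apply: xd; apply/(rV_ballP _ _ d0) => i; have := yk i.
rewrite !mxE ck ek -ler_distl => yq.
have := ltrD (xq i) (le_lt_trans yq md); have := xq i; have := md.
rewrite (distrC (y ord0 i)) => h1 h2.
move=> /(le_lt_trans (ler_normD _ _)); rewrite addrA subrK => h.
by apply: lt_le_trans h _; rewrite [leRHS]splitr lerD2r ltW.
Qed.

Lemma open_measurable_rV (A : set 'rV[R]_n) : open A -> measurable A.
Proof.
move=> /open_box_cover[D [l [r [_ ->]]]].
by apply: bigcup_measurable => k _; exact: measurable_box.
Qed.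

Lemma continuous_measurable_rV (f : 'rV[R]_n -> R) :
  continuous f -> measurable_fun setT f.
Proof.
move=> cf; apply: (measurability _ (RGenOInfty.measurableE R)).
move=> _ [_ [x ->] <-]; rewrite setTI; apply: open_measurable_rV.
apply: open_comp; first by move=> y _; exact: cf.
exact: interval_open.
Qed.

(** Boxes are stable under intersection, so this generation result opens the way to Dynkin
    induction. A half-space in one coordinate is a countable union of boxes that grow in all the
    other directions. *)
Lemma measurable_box_generated :
  measurable = <<s [set box a b | a in [set: 'rV[R]_n] & b in [set: 'rV[R]_n]] >>.
Proof.
apply/seteqP; split; last first.
  apply: smallest_sub; first exact: sigma_algebra_measurable.
  by move=> _ [a _ [b _ <-]]; exact: measurable_box.
apply: smallest_sub; first exact: smallest_sigma_algebra.
set G := [set box a b | a in _ & b in _].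
move=> A; rewrite -bigcup_seq => -[i _ [Y mY <-]]; rewrite setTI.
have mi : measurable_fun [set: g_sigma_algebraType G]
    (fun v : 'rV[R]_n => v ord0 i).
  apply: (measurability _ (RGenOInfty.measurableE R)).
  move=> _ [_ [x ->] <-]; rewrite setTI.
  rewrite (_ : _ @^-1` _ = \bigcup_k
      box (\row_j (if j == i then x else - k%:R)) (const_mx k%:R)).
    apply: bigcupT_measurable => k; apply: sub_sigma_algebra.
    by eexists => //; eexists.
  apply/seteqP; split=> [v /=|v [k _] /(_ i)]; last first.
    by rewrite !mxE eqxx => /andP[? _] /=; rewrite in_itv/= andbT.
  rewrite in_itv/= andbT => xv.
  have [k vk] : exists k : nat, forall j, `|v ord0 j| < k%:R.
    exists (Num.truncn (\sum_j `|v ord0 j|)).+1 => j.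
    apply: le_lt_trans (truncnS_gt _).
    by rewrite (bigD1 j)//= lerDl sumr_ge0.
  exists k => // j; rewrite !mxE; have := vk j; rewrite ltr_norml.
  by case: eqP => [->|//] /andP[_ ->]; rewrite xv.
by have := mi measurableT _ mY; rewrite setTI.
Qed.

End box.

Section lebesgue_rV_theory.
Context {R : realType}.
Local Open Scope ereal_scope.

Lemma ge0_integral_rV_cons n (f : 'rV[R]_n.+1 -> \bar R) :
  measurable_fun setT f -> (forall x, 0 <= f x) ->
  \int[lebesgue_rV n.+1]_x f x =
  \int[lebesgue_measure \x lebesgue_rV n]_av f (rV_cons av).
Proof.
move=> mf f0; rewrite [LHS](_ : _ = \int[pushforward
  (lebesgue_measure \x lebesgue_rV n) (@rV_cons R n)]_x f x)//.
by rewrite ge0_integral_pushforward//; exact: measurable_rV_cons.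
Qed.

Lemma integrable_rV_cons n (f : 'rV[R]_n.+1 -> \bar R) :
  (lebesgue_rV n.+1).-integrable setT f ->
  (lebesgue_measure \x lebesgue_rV n).-integrable setT (f \o @rV_cons R n).
Proof.
move=> /integrableP[mf foo]; apply/integrableP; split.
  by apply: measurableT_comp => //; exact: measurable_rV_cons.
rewrite ge0_integral_rV_cons// in foo.
exact: measurableT_comp.
Qed.

(** [lebesgue_rV n.+1] unfolds to the pushforward of a product, so that Fubini can peel off one
    coordinate in the inductions on the dimension. *)
Lemma integral_rV_cons n (f : 'rV[R]_n.+1 -> \bar R) :
  (lebesgue_rV n.+1).-integrable setT f ->
  \int[lebesgue_rV n.+1]_x f x =
  \int[lebesgue_measure \x lebesgue_rV n]_av f (rV_cons av).
Proof.
move=> intf; rewrite [LHS](_ : _ = \int[pushforward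
  (lebesgue_measure \x lebesgue_rV n) (@rV_cons R n)]_x f x)//.
have [mf _] := integrableP _ _ _ intf.
have := @integral_pushforward _ _ _ _ _ _ (@measurable_rV_cons R n)
  (lebesgue_measure \x lebesgue_rV n) setT f mf.
by rewrite preimage_setT => -> //; exact: integrable_rV_cons.
Qed.

Lemma lebesgue_box n (a b : 'rV[R]_n) : (forall i, a ord0 i <= b ord0 i)%R ->
  lebesgue_rV n (box a b) = (\prod_i (b ord0 i - a ord0 i))%:E.
Proof.
elim: n a b => [a b _|n IH a b ab].
  by rewrite big_ord0 /= diracE mem_set// => -[].
rewrite [LHS](_ : _ = (lebesgue_measure \x lebesgue_rV n)
    (`]a ord0 ord0, b ord0 ord0[%classic `*`
     box (\row_j a ord0 (lift ord0 j)) (\row_j b ord0 (lift ord0 j)))).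
  rewrite product_measure1E//; last exact: measurable_box.
  rewrite [X in X * _](lebesgue_measure_itv `]a ord0 ord0, b ord0 ord0[)/= lte_fin.
  rewrite IH => [|i]; last by rewrite !mxE.
  rewrite big_ord_recl EFinM; congr (_ * _).
    case: ifPn => // ; rewrite -leNgt => h.
    by have -> : a ord0 ord0 = b ord0 ord0 by [apply/eqP; rewrite eq_le h ab]; rewrite subrr.
  by congr EFin; apply: eq_bigr => i _; rewrite !mxE.
have <- : @rV_cons R n @^-1` box a b = `]a ord0 ord0, b ord0 ord0[%classic `*`
     box (\row_j a ord0 (lift ord0 j)) (\row_j b ord0 (lift ord0 j)); last by [].
apply/seteqP; split=> -[s v] /=.
  move=> h; split.
    by have := h ord0; rewrite !mxE unlift_none in_itv.
  by move=> i; have := h (lift ord0 i); rewrite !mxE liftK.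
move=> [h1 h2] i; rewrite !mxE; case: unliftP => [j ->|->].
  by have := h2 j; rewrite !mxE.
by move: h1; rewrite in_itv.
Qed.

Lemma lebesgue_box_lty n (a b : 'rV[R]_n) : lebesgue_rV n (box a b) < +oo.
Proof.
have [ab|] := pselect (forall i, a ord0 i <= b ord0 i)%R.
  by rewrite lebesgue_box// ltry.
move=> /existsNP[i /negP]; rewrite -ltNge => ba.
rewrite (_ : box a b = set0) ?measure0//.
apply/seteqP; split=> // z /(_ i) /andP[h1 h2].
by have := lt_trans (lt_trans h1 h2) ba; rewrite ltxx.
Qed.

End lebesgue_rV_theory.

(** * Smooth functions on the line *)

(* Generated by the functions x^-k e^(-1/x), extended by 0 to x <= 0, whose
   derivatives are again of this form; this makes the class closed under
   differentiation. *)
Inductive smooth1 {R : realType} : (R -> R) -> Prop :=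
| smooth1_flat k :
    smooth1 (fun x => if 0 < x then x^-1 ^+ k * expR (- x^-1) else 0)
| smooth1_cst c : smooth1 (fun=> c)
| smooth1D f g : smooth1 f -> smooth1 g -> smooth1 (fun x => f x + g x)
| smooth1M f g : smooth1 f -> smooth1 g -> smooth1 (fun x => f x * g x)
| smooth1V f : (forall x, f x != 0) -> smooth1 f -> smooth1 (fun x => (f x)^-1)
| smooth1_affine f a b : smooth1 f -> smooth1 (fun x => f (a * x + b)).

Section smooth1_theory.
Context {R : realType}.
Implicit Types (f g : R -> R).

Lemma expR_flat (k : nat) (y : R) : 0 <= y ->
  y ^+ k * expR (- y) <= k`!%:R.
Proof.
move=> y0; rewrite expRN ler_pdivrMr ?expR_gt0//.
case: k => [|k]; first by rewrite expr0 fact0 mul1r -[leLHS]expR0 ler_expR.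
have := expR_ge1Dxn k y0; have f0 : 0 < k.+1`!%:R :> R by rewrite ltr0n fact_gt0.
move=> h; rewrite mulrC -ler_pdivrMr//; by apply: le_trans h; rewrite lerDr.
Qed.

Lemma is_derive_cvg (V W : normedModType R) (f : V -> W) a v l :
  h^-1 *: ((f \o shift a) (h *: v) - f a) @[h --> 0^'] --> l ->
  is_derive a v f l.
Proof.
by move=> fl; apply: DeriveDef; [exact: cvgP fl|exact: cvg_lim fl].
Qed.

Lemma is_derive_flat k (x : R) :
  is_derive x 1 (fun x => if 0 < x then x^-1 ^+ k * expR (- x^-1) else 0)
   ((fun x => if 0 < x then x^-1 ^+ k.+2 * expR (- x^-1) else 0) x +
    - k%:R * (fun x => if 0 < x then x^-1 ^+ k.+1 * expR (- x^-1) else 0) x).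
Proof.
have [x0|x0|->] /= := ltgtP x 0.
- rewrite mulr0 addr0; apply: (@near_eq_is_derive _ _ _ (cst 0)) => //.
  near=> y; rewrite ltNge ifF//; apply/negbTE; rewrite negbK ltW//.
  by near: y; exact: lt_nbhsl.
- apply: (@near_eq_is_derive R R R (fun x : R => x^-1 ^+ k * expR (- x^-1))) => //.
    near=> y; rewrite ifT//; near: y; exact: lt_nbhsr.
  have xN0 : x != 0 by rewrite gt_eqF.
  have dV : is_derive x 1 (fun y : R => y^-1) (- x ^- 2).
    apply: is_derive_eq (is_deriveV xN0 (is_derive_id x 1)) _.
    by rewrite /GRing.scale/= mulr1.
  have dE : is_derive x 1 (fun y : R => expR (- y^-1)) (expR (- x^-1) * x ^- 2).
    apply: is_derive1_comp (is_derive_expR _) _.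
    by apply: is_derive_eq (is_deriveN dV) _; rewrite opprK.
  rewrite (_ : (fun y : R => _) = (fun y => y^-1) ^+ k * (fun y => expR (- y^-1))).
    2: by apply/funext => y; rewrite !fctE.
  apply: is_derive_eq (is_deriveM (is_deriveX k dV) dE) _.
  rewrite /GRing.scale/= !fctE.
  case: k => [|k]; first by rewrite !mul0r mulr0 oppr0 mul0r !addr0 expr0 mul1r exprVn mulrC.
  by rewrite -exprVn; set e := expR _; set y := x^-1; rewrite !exprS; ring.
- rewrite ?ltxx mulr0 addr0; apply: is_derive_cvg; apply/cvgr0Pnorm_le => e e0.
  have C0 : 0 < (k.+2)`!%:R :> R by rewrite ltr0n fact_gt0.
  near=> h; rewrite /= ltxx subr0 addr0 /GRing.scale/= mulr1.
  case: ifPn => [h0|_]; last by rewrite mulr0 normr0 ltW.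
  have hV0 : 0 <= h^-1 by rewrite invr_ge0 ltW.
  rewrite ger0_norm; last by rewrite !mulr_ge0// ?exprn_ge0// expR_ge0.
  (* With y = 1/h, the difference quotient equals h y^(k+2) e^(-y): one extra power comes from
     dividing by h, the other is spent to produce the factor h that tends to 0. *)
  have := expR_flat k.+2 hV0; rewrite 2!exprS => hk.
  have -> : h^-1 * (h^-1 ^+ k * expR (- h^-1)) =
      h * (h^-1 * (h^-1 * h^-1 ^+ k) * expR (- h^-1)).
    by rewrite !mulrA mulfV ?gt_eqF// mul1r.
  apply: (@le_trans _ _ (h * (k.+2)`!%:R)); first by rewrite ler_pM2l.
  rewrite -ler_pdivlMr//; apply: le_trans (ler_norm _) _.
  by near: h; apply: dnbhs0_le; rewrite divr_gt0.
Unshelve. all: by end_near.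
Qed.

Lemma smooth1_is_derive f : smooth1 f ->
  exists2 g : R -> R, smooth1 g & forall x : R, is_derive x 1 f (g x).
Proof.
elim=> {f}[k|c|f g sf [f' sf' ff'] sg [g' sg' gg']
  |f g sf [f' sf' ff'] sg [g' sg' gg']|f f0 sf [f' sf' ff']
  |f a b sf [f' sf' ff']].
- eexists; last exact: is_derive_flat.
  apply: smooth1D; [exact: smooth1_flat|apply: smooth1M].
    exact: smooth1_cst.
  exact: smooth1_flat.
- by exists (fun=> 0) => [|x]; [exact: smooth1_cst|exact: is_derive_cst].
- by exists (fun x => f' x + g' x) => [|x]; [exact: smooth1D|exact: is_deriveD].
- exists (fun x => f x * g' x + g x * f' x) => [|x]; last exact: is_deriveM.
  by apply: smooth1D; apply: smooth1M.
- exists (fun x => -1 * ((f x)^-1 * (f x)^-1) * f' x) => [|x].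
    apply: smooth1M => //; apply: smooth1M; first exact: smooth1_cst.
    by apply: smooth1M; apply: smooth1V.
  apply: is_derive_eq (is_deriveV (f0 x) (ff' x)) _.
  by rewrite /GRing.scale/= -exprVn expr2 mulN1r.
- exists (fun x => a * f' (a * x + b)) => [|x].
    by apply: smooth1M; [exact: smooth1_cst|exact: smooth1_affine].
  rewrite mulrC; apply: is_derive1_comp => //.
  apply: is_derive_eq (is_deriveD (is_deriveZ a (is_derive_id x 1)) (is_derive_cst b x 1)) _.
  by rewrite addr0 /GRing.scale/= mulr1.
Qed.

Lemma is_derive_continuous f (g : R -> R) :
  (forall x : R, is_derive x 1 f (g x)) -> continuous f.
Proof.
by move=> fg x; apply/differentiable_continuous/derivable1_diffP; case: (fg x).
Qed.

Lemma smooth1_continuous f : smooth1 f -> continuous f.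
Proof. by case/smooth1_is_derive => g _; exact: is_derive_continuous. Qed.

Definition flat (x : R) : R := if 0 < x then expR (- x^-1) else 0.

Lemma smooth1_flat0 : smooth1 flat.
Proof.
have -> : flat = (fun x => if 0 < x then x^-1 ^+ 0 * expR (- x^-1) else 0).
  by apply/funext => x; rewrite expr0 mul1r.
exact: smooth1_flat.
Qed.

Definition smooth_step (x : R) : R :=
  flat (x + 1) / (flat (x + 1) + flat (1 - x)).

Lemma flat_ge0 x : 0 <= flat x.
Proof. by rewrite /flat; case: ifP => // _; exact: expR_ge0. Qed.

Lemma flat_gt0 x : 0 < x -> 0 < flat x.
Proof. by rewrite /flat => ->; exact: expR_gt0. Qed.

Lemma flat_eq0 x : x <= 0 -> flat x = 0.
Proof. by rewrite /flat ltNge => ->. Qed.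

Lemma smooth_step_den x : 0 < flat (x + 1) + flat (1 - x).
Proof.
have [x0|x0] := leP x 0.
  by rewrite ltr_wpDl ?flat_ge0// flat_gt0//; lra.
by rewrite ltr_pwDl ?flat_ge0// flat_gt0//; lra.
Qed.

Lemma smooth1_step : smooth1 smooth_step.
Proof.
have h1 : smooth1 (fun x => flat (x + 1)).
  rewrite (_ : (fun _ => _) = (fun x => flat (1 * x + 1))).
    exact/smooth1_affine/smooth1_flat0.
  by apply/funext => x; rewrite mul1r.
have h2 : smooth1 (fun x => flat (1 - x)).
  rewrite (_ : (fun _ => _) = (fun x => flat (-1 * x + 1))).
    exact/smooth1_affine/smooth1_flat0.
  by apply/funext => x; rewrite mulN1r addrC.
apply: smooth1M => //; apply: smooth1V; last exact: smooth1D.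
by move=> x; rewrite gt_eqF ?smooth_step_den.
Qed.

Lemma smooth_step_ge0 x : 0 <= smooth_step x.
Proof. by rewrite divr_ge0 ?flat_ge0// ltW// smooth_step_den. Qed.

Lemma smooth_step_le1 x : smooth_step x <= 1.
Proof. by rewrite ler_pdivrMr ?smooth_step_den// mul1r lerDl flat_ge0. Qed.

Lemma smooth_step0 x : x <= -1 -> smooth_step x = 0.
Proof. by move=> x1; rewrite /smooth_step flat_eq0 ?mul0r//; lra. Qed.

Lemma smooth_step1 x : 1 <= x -> smooth_step x = 1.
Proof.
move=> x1; rewrite /smooth_step (@flat_eq0 (1 - x)); last by lra.
by rewrite addr0 divff// gt_eqF// flat_gt0//; lra.
Qed.

(** As the derivative of a transition from 0 to 1, it has integral 1 and is a one-dimensional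
    mollifier with an explicit primitive. The choice by [xget] keeps it inside [smooth1] without a
    closed formula. *)
Definition step_bump : R -> R := xget (fun=> 0)
  [set g : R -> R | smooth1 g /\ forall x : R, is_derive x 1 smooth_step (g x)].

Let step_bumpP : smooth1 step_bump /\ forall x : R, is_derive x 1 smooth_step (step_bump x).
Proof.
rewrite /step_bump; case: xgetP => [_ -> //|] h.
by have [g sg gP] := smooth1_is_derive smooth1_step; have := h g; case.
Qed.

Lemma smooth1_step_bump : smooth1 step_bump.
Proof. by case: step_bumpP. Qed.

Lemma is_derive_smooth_step (x : R) : is_derive x 1 smooth_step (step_bump x).
Proof. by case: step_bumpP. Qed.

Lemma step_bump0 x : 1 < `|x| -> step_bump x = 0.
Proof.
have [_ dstep] := step_bumpP; have [dx <-] := dstep x.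
rewrite lter_normr => /orP[x1|x1].
- rewrite (@near_eq_derive R R R _ (cst 1)) ?derive_cst//.
  by near=> y; rewrite smooth_step1//; near: y; exact: lt_le_nbhsr.
- rewrite (@near_eq_derive R R R _ (cst 0)) ?derive_cst//.
  by near=> y; rewrite smooth_step0//; near: y; apply: lt_le_nbhsl; rewrite ltrNr.
Unshelve. all: by end_near. Qed.

Lemma step_bump_bounded : exists2 B : R, 0 < B & forall x, `|step_bump x| <= B.
Proof.
have c : {within `[(-1)%R, 1%R], continuous (fun x => `|step_bump x|)}.
  apply: continuous_subspaceT => x.
  apply: continuous_comp; last exact: norm_continuous.
  exact/smooth1_continuous/smooth1_step_bump.
have [|M _ hM] := EVT_max _ c; first by lra.
exists (`|step_bump M| + 1) => [|x]; first by rewrite ltr_wpDl.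
have [x1|x1] := ltP 1 `|x|; first by rewrite step_bump0// normr0 addr_ge0.
rewrite (le_trans (hM x _)) ?lerDl// in_itv/=.
by rewrite -ler_norml.
Qed.

End smooth1_theory.

(** * Tensor products, integration by parts and weak gradients *)

Definition tensor {R : realType} n (b : 'I_n -> R -> R) (z : 'rV[R]_n) : R :=
  \prod_i b i (z ord0 i).

Section tensor.
Context {R : realType} {n : nat}.
Implicit Types (b c : 'I_n -> R -> R) (x y z : 'rV[R]_n).

Lemma compact_cbox (l r : 'rV[R]_n) : compact (cbox l r).
Proof.
rewrite (_ : cbox l r = [set v | forall i, `[l ord0 i, r ord0 i]%classic (v ord0 i)]).
  apply: (@rV_compact R n (fun i => `[l ord0 i, r ord0 i]%classic)) => i.
  exact: segment_compact.
by apply/seteqP; split=> v /= h i; have := h i; rewrite in_itv.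
Qed.

Lemma closed_cbox (l r : 'rV[R]_n) : closed (cbox l r).
Proof. by apply: (compact_closed (@norm_hausdorff R _)); exact: compact_cbox. Qed.

Lemma closed_measurable_rV (A : set 'rV[R]_n) : closed A -> measurable A.
Proof.
move=> cA; rewrite -(setCK A); apply: measurableC; apply: open_measurable_rV.
exact: closed_openC.
Qed.

Lemma compact_measurable_rV (A : set 'rV[R]_n) : compact A -> measurable A.
Proof.
move=> cA; apply: closed_measurable_rV.
exact: (compact_closed (@norm_hausdorff R _)).
Qed.

Lemma measurable_cbox (l r : 'rV[R]_n) : measurable (cbox l r).
Proof. by apply: closed_measurable_rV; exact: closed_cbox. Qed.

(** Both difference quotients are the same function of h. One-variable rules, the chain rule in
    particular, thus apply to directional derivatives. *)
Lemma is_derive_line (u : 'rV[R]_n -> R) x (e : 'rV[R]_n) (s l : R) :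
  is_derive s (1 : R) (fun h => u (h *: e + x)) l <-> is_derive (s *: e + x) e u l.
Proof.
have E : (fun h : R => h^-1 *: (((fun h => u (h *: e + x)) \o shift s)
      (h *: (1 : R)) - u (s *: e + x))) =
    (fun h => h^-1 *: ((u \o shift (s *: e + x)) (h *: e) - u (s *: e + x))).
  by apply/funext => h /=; rewrite [h *: (1 : R)]mulr1 scalerDl addrA.
split=> -[+ <-].
  by rewrite /derivable => d; apply: DeriveDef; rewrite /derivable/derive -E.
by rewrite /derivable => d; apply: DeriveDef; rewrite /derivable/derive E.
Qed.

Lemma tensorD1 b i x h : tensor b (h *: delta_mx ord0 i + x) =
  (\prod_(j | j != i) b j (x ord0 j)) * b i (h + x ord0 i).
Proof.
rewrite /tensor (bigD1 i)//= !mxE !eqxx mulr1 mulrC; congr (_ * _).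
by apply: eq_bigr => j /negPf ji; rewrite !mxE eqxx ji mulr0 add0r.
Qed.

Lemma is_derive_tensor b i (g : R -> R) x :
  (forall s : R, is_derive s 1 (b i) (g s)) ->
  is_derive x (delta_mx ord0 i) (tensor b)
    (tensor (fun j => if j == i then g else b j) x).
Proof.
move=> bg; rewrite -{1}[x]add0r -{1}(scale0r (delta_mx ord0 i)).
apply/is_derive_line; under eq_fun do rewrite tensorD1.
rewrite -[X in tensor _ X]add0r -{1}(scale0r (delta_mx ord0 i)) tensorD1 eqxx.
have -> : \prod_(j | j != i) (if j == i then g else b j) (x ord0 j) =
    \prod_(j | j != i) b j (x ord0 j) by apply: eq_bigr => j /negPf ->.
apply: is_deriveZ; rewrite -[g _]mulr1.
apply: (@is_derive1_comp _ (b i) (fun h => h + x ord0 i) 0 _ 1) => //.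
exact: is_derive_shift.
Qed.

Lemma continuous_tensor b : (forall i, continuous (b i)) -> continuous (tensor b).
Proof.
move=> cb; apply: (@continuous_big R 'I_n _ 1 xpredT mul_continuous) => i _ x.
by apply: continuous_comp; [exact: coord_continuous|exact: cb].
Qed.

Lemma test_tensor (G : set 'rV[R]_n) b (l r : 'rV[R]_n) :
  (forall i, smooth1 (b i)) ->
  (forall i s, b i s != 0 -> l ord0 i <= s <= r ord0 i) ->
  cbox l r `<=` G -> test_function G (tensor b).
Proof.
move=> sb lr KG; pose K := closure [set x | tensor b x != 0].
have KK : K `<=` cbox l r.
  rewrite ((closure_id _).1 (@closed_cbox l r)).
  apply: closure_subset => z /= /prodf_neq0 h i; apply: lr; exact: h.
split.
- move=> s; rewrite /=.
  (* A partial derivative of a tensor product only changes one factor, which stays in [smooth1];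
     hence every iterated partial derivative is again such a product. *)
  have [c [sc ->]] : exists c, (forall i, smooth1 (c i)) /\
      foldr partial (tensor b) s = tensor c.
    elim: s => [|i s [c [sc /= ->]]]; first by exists b.
    have [g sg cg] := smooth1_is_derive (sc i).
    exists (fun j => if j == i then g else c j); split=> [j|].
      by case: ifP.
    by apply/funext => x; case: (is_derive_tensor x cg).
  split=> [|i x].
    by apply: continuous_tensor => i; exact: smooth1_continuous.
  have [g sg cg] := smooth1_is_derive (sc i).
  by case: (is_derive_tensor x cg).
- exact: (subclosed_compact (@closed_closure _ _) (@compact_cbox l r) KK).
- exact: subset_trans KG.
Qed.

End tensor.

(** * Integrals of partial derivatives of compactly supported functions *)

Section integral_partial.
Context {R : realType}.
Local Open Scope ereal_scope.

Lemma integrable_bounded_box n (f : 'rV[R]_n -> R) (a b : 'rV[R]_n) (B : R) :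
  measurable_fun setT f -> (forall x, `|f x| <= B)%R ->
  (forall x, ~ box a b x -> f x = 0%R) ->
  (lebesgue_rV n).-integrable setT (EFin \o f).
Proof.
move=> mf fB f0.
have -> : EFin \o f = (EFin \o f) \_ (box a b).
  apply/funext => x; rewrite patchE; case: ifPn => //.
  by rewrite notin_setE => /f0 /= ->.
apply/integrable_restrict => //; first exact: measurable_box.
rewrite setTI; apply: measurable_bounded_integrable.
- exact: measurable_box.
- exact: lebesgue_box_lty.
- exact: measurable_funS mf.
- exists B; split; first exact: num_real.
  by move=> C BC x _; apply: le_trans (fB x) (ltW BC).
Qed.

Lemma integral_derive_compact (psi d : R -> R) (a b : R) :
  (forall s : R, is_derive s 1%R psi (d s)) -> continuous d ->
  (forall s, ~~ (a < s < b)%R -> d s = 0%R) -> (a < b)%R ->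
  \int[lebesgue_measure]_s (d s)%:E = (psi b - psi a)%:E.
Proof.
move=> dpsi cd d0 ab.
have cpsi : continuous psi by exact: is_derive_continuous dpsi.
have -> : \int[lebesgue_measure]_s (d s)%:E =
    \int[lebesgue_measure]_(s in `[a, b]) (d s)%:E.
  rewrite [RHS]integral_mkcond; apply: eq_integral => s _.
  rewrite patchE; case: ifPn => //; rewrite notin_setE/= in_itv/= => h.
  rewrite d0//; apply/negP => /andP[h1 h2]; apply: h.
  by rewrite !ltW.
rewrite (@continuous_FTC2 _ _ psi)//.
- exact: continuous_subspaceT.
- split.
  + by move=> x _; case: (dpsi x).
  + by apply: cvg_at_right_filter; exact: cpsi.
  + by apply: cvg_at_left_filter; exact: cpsi.
- by move=> x _; rewrite derive1E; case: (dpsi x).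
Qed.

Lemma rV_cons_line n a (v : 'rV[R]_n) :
  rV_cons (a, v) = (a *: delta_mx ord0 ord0 + rV_cons (0%R, v))%R :> 'rV[R]_n.+1.
Proof.
apply/rowP => i; rewrite !mxE; case: unliftP => [j ->|->] /=.
  by rewrite ?andbF mulr0 add0r.
by rewrite ?eqxx mulr1 addr0.
Qed.

Lemma rV_cons_lift n (a s : R) i (v : 'rV[R]_n) :
  rV_cons (a, s *: delta_mx ord0 i + v)%R =
  (s *: delta_mx ord0 (lift ord0 i) + rV_cons (a, v))%R :> 'rV[R]_n.+1.
Proof.
apply/rowP => k; rewrite !mxE; case: unliftP => [j ->|->] /=.
  by rewrite !mxE (inj_eq lift_inj).
by rewrite ?andbF mulr0 add0r.
Qed.

(** Fubini in the first coordinate: if i is that coordinate, the inner integral vanishes by the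
    fundamental theorem of calculus; otherwise freeze it and use the induction hypothesis.
    Differentiability is assumed along lines so that the hypotheses survive the freezing. *)
Lemma integral_partial_eq0 n (i : 'I_n) (psi d : 'rV[R]_n -> R) (M B : R) :
  (0 < M)%R -> measurable_fun setT d -> (forall x, `|d x| <= B)%R ->
  (forall x, ~ box (const_mx (- M)%R) (const_mx M) x -> d x = 0%R) ->
  (forall x, ~ box (const_mx (- M)%R) (const_mx M) x -> psi x = 0%R) ->
  (forall x, continuous (fun s : R => d (s *: delta_mx ord0 i + x)%R)) ->
  (forall x (s : R), is_derive s 1%R (fun s => psi (s *: delta_mx ord0 i + x)%R)
      (d (s *: delta_mx ord0 i + x)%R)) ->
  \int[lebesgue_rV n]_x (d x)%:E = 0.
Proof.
elim: n i psi d => [[]//|n IH] i psi d M0 md dB d0 psi0 cd dpsi.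
have intd := integrable_bounded_box md dB d0.
have intc := integrable_rV_cons intd.
have consT : measurable_fun setT (@rV_cons R n) by exact: measurable_rV_cons.
rewrite integral_rV_cons//.
case: (unliftP ord0 i) => [j|] ij; subst i.
  rewrite -(integral12_prod_meas1 intc) integral0_eq// => a _.
  apply: (IH j (fun v => psi (rV_cons (a, v)))) => //.
  - apply: measurableT_comp; first exact: md.
    apply: measurableT_comp; first exact: consT.
    exact: measurable_fun_pair.
  - move=> x h; apply: d0; apply: contra_not h => h k.
    by have := h (lift ord0 k); rewrite !mxE liftK.
  - move=> x h; apply: psi0; apply: contra_not h => h k.
    by have := h (lift ord0 k); rewrite !mxE liftK.
  - by move=> x; under eq_fun do rewrite rV_cons_lift; exact: cd.
  - move=> x s; rewrite rV_cons_lift; under eq_fun do rewrite rV_cons_lift.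
    exact: dpsi.
rewrite -(integral21_prod_meas1 intc) integral0_eq// => v _.
have out s : ~~ (- M < s < M)%R -> ~ box (const_mx (- M)%R) (const_mx M)
    (s *: delta_mx ord0 ord0 + rV_cons (0%R, v))%R.
  by move=> /negP h /(_ ord0); rewrite !mxE unlift_none !eqxx mulr1 addr0.
have psi_out s : ~~ (- M < s < M)%R ->
    psi (s *: delta_mx ord0 ord0 + rV_cons (0%R, v))%R = 0%R by move=> /out /psi0.
transitivity (psi (M *: delta_mx ord0 ord0 + rV_cons (0%R, v)) -
    psi ((- M) *: delta_mx ord0 ord0 + rV_cons (0%R, v)))%:E; last first.
  by rewrite !psi_out ?ltxx ?andbF// subrr.
rewrite -(@integral_derive_compact
  (fun s => psi (s *: delta_mx ord0 ord0 + rV_cons (0%R, v)))%R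
  (fun s => d (s *: delta_mx ord0 ord0 + rV_cons (0%R, v)))%R (- M) M) //.
- by apply: eq_integral => a _; rewrite /= rV_cons_line.
- by move=> s /out /d0.
- by rewrite gtrN.
Qed.

End integral_partial.

(** * The fundamental lemma of the calculus of variations *)

Section fundamental_lemma.
Context {R : realType} {n : nat}.
Local Notation mu := (@lebesgue_rV R n).
Local Open Scope ereal_scope.

(** Dynkin induction extends the vanishing of the integral from boxes to all measurable sets; the
    integral over the whole space is what handles complements. *)
Lemma ae0_of_box_integrals (h : 'rV[R]_n -> \bar R) :
  mu.-integrable setT h -> \int[mu]_x h x = 0 ->
  (forall a b, \int[mu]_(x in box a b) h x = 0) ->
  {ae mu, forall x, h x = 0}.
Proof.
move=> ih hT hbox.
have ihS S : measurable S -> mu.-integrable S h.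
  by move=> mS; exact: integrableS ih.
have H : forall S, measurable S -> \int[mu]_(x in S) h x = 0.
  rewrite measurable_box_generated.
  apply: (dynkin_induction measurable_box_generated) => //.
  - move=> _ _ [a _ [b _ <-]] [c _ [d _ <-]]; rewrite boxI.
    by eexists => //; eexists.
  - by move=> _ [a _ [b _ <-]].
  - move=> S mS hS; rewrite -hT -(setUv S) integral_setU//.
    + by rewrite hS add0e.
    + exact: measurableC.
    + by rewrite setUv; exact: measurable_int ih.
    + by rewrite disj_set2E setICr eqxx.
  - move=> F mF tF hF; rewrite integral_bigcup//.
      by rewrite eseries0.
    by apply: ihS; exact: bigcupT_measurable.
have := @integral_ae_eq _ _ _ mu setT measurableT (cst 0) h ih.
case=> [||A]; first exact: measurable_cst.
  by move=> E _ mE; rewrite H// integral_cst// mul0e.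
case=> mA A0 sub; exists A; split => // x hx; apply: sub => /=.
by apply: contra_not hx; apply.
Qed.

(** The two arguments are k (s - l_i) - 1 and k (r_i - s) - 1, in affine form. The shift by 1 makes
    the approximation vanish outside of the interval, and it equals 1 once k times the distance to
    each endpoint is at least 2. *)
Definition box_approx (l r : 'rV[R]_n) (k : nat) (i : 'I_n) (s : R) : R :=
  (smooth_step (k%:R * s + (- (k%:R * l ord0 i) - 1)) *
   smooth_step (- k%:R * s + (k%:R * r ord0 i - 1)))%R.

Lemma smooth1_box_approx l r k i : smooth1 (box_approx l r k i).
Proof. by apply: smooth1M; apply: smooth1_affine; exact: smooth1_step. Qed.

Lemma box_approx_supp l r k i s :
  box_approx l r k i s != 0%R -> (l ord0 i <= s <= r ord0 i)%R.
Proof.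
rewrite /box_approx mulf_eq0 negb_or => /andP[h1 h2]; apply/andP; split.
  rewrite leNgt; apply: contra h1 => sl; rewrite smooth_step0//.
  by rewrite addrA -mulrBr gerDr mulr_ge0_le0// subr_le0 ltW.
rewrite leNgt; apply: contra h2 => sl; rewrite smooth_step0//.
rewrite addrA mulNr (addrC (- _)%R) -mulrBr gerDr mulr_ge0_le0//.
by rewrite subr_le0 ltW.
Qed.

Lemma tensor_box_approx_bound l r k x :
  (0 <= tensor (box_approx l r k) x <= 1)%R.
Proof.
rewrite /tensor; elim/big_ind : _ => [|a b /andP[a0 a1] /andP[b0 b1]|i _].
- by rewrite ler01 lexx.
- by rewrite mulr_ge0// mulr_ile1.
- by rewrite mulr_ge0 ?smooth_step_ge0//= mulr_ile1 ?smooth_step_ge0 ?smooth_step_le1.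
Qed.

Lemma tensor_box_approx_cvg l r x :
  \forall k \near \oo, tensor (box_approx l r k) x = \1_(box l r) x.
Proof.
have [xlr|] := pselect (box l r x); last first.
  move=> nx; near=> k; rewrite indicE memNset//.
  move: nx => /existsNP[i /negP nx].
  rewrite /tensor (bigD1 i)//= /box_approx.
  suff -> : (smooth_step (k%:R * x ord0 i + (- (k%:R * l ord0 i) - 1)) *
      smooth_step (- k%:R * x ord0 i + (k%:R * r ord0 i - 1)) = 0)%R.
    by rewrite mul0r.
  apply/eqP; rewrite mulf_eq0; move: nx; rewrite negb_and -!leNgt.
  case/orP => h; [apply/orP; left|apply/orP; right]; rewrite smooth_step0//.
    by rewrite addrA -mulrBr gerDr mulr_ge0_le0// subr_le0.
  rewrite addrA mulNr (addrC (- _)%R) -mulrBr gerDr mulr_ge0_le0//.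
  by rewrite subr_le0.
have [K HK] : exists K : nat, forall i, (2 <= K%:R * (x ord0 i - l ord0 i))%R /\
    (2 <= K%:R * (r ord0 i - x ord0 i))%R.
  pose S := (\sum_i (2 / (x ord0 i - l ord0 i) + 2 / (r ord0 i - x ord0 i)))%R.
  exists (Num.truncn S).+1 => i; have /andP[xl xr] := xlr i.
  have SK := truncnS_gt S.
  have t1 : (0 <= 2 / (x ord0 i - l ord0 i))%R by rewrite divr_ge0// subr_ge0 ltW.
  have t2 : (0 <= 2 / (r ord0 i - x ord0 i))%R by rewrite divr_ge0// subr_ge0 ltW.
  have iS : (2 / (x ord0 i - l ord0 i) + 2 / (r ord0 i - x ord0 i) <= S)%R.
    rewrite /S (bigD1 i)//= lerDl sumr_ge0// => j _.
    by have /andP[? ?] := xlr j; rewrite addr_ge0// divr_ge0// subr_ge0 ltW.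
  by split; rewrite -ler_pdivrMr ?subr_gt0// (le_trans _ (ltW SK))//;
    apply: le_trans iS; rewrite ?lerDl ?lerDr.
near=> k; rewrite indicE mem_set// /tensor big1// => i _.
have /andP[xl xr] := xlr i; have [h1 h2] := HK i.
have Kk : (K%:R <= k%:R :> R)%R by rewrite ler_nat; near: k; exact: nbhs_infty_ge.
rewrite /box_approx !smooth_step1 ?mulr1//.
  rewrite addrA mulNr (addrC (- _)%R) -mulrBr lerBrDr (le_trans h2)//.
  by rewrite ler_pM2r// subr_gt0.
rewrite addrA -mulrBr lerBrDr (le_trans h1)//.
by rewrite ler_pM2r// subr_gt0.
Unshelve. all: by end_near. Qed.

Lemma locally_integrable_restrict (G : set 'rV[R]_n) (g : 'rV[R]_n -> R)
    (K : set 'rV[R]_n) :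
  measurable G -> locally_integrable_rV G g -> measurable K -> compact K ->
  K `<=` G -> mu.-integrable K (EFin \o g).
Proof.
move=> mG [mg gK] mK cK KG; apply/integrableP; split.
  by apply/measurable_EFinP; exact: measurable_funS mg.
by have := gK _ cK KG; under eq_integral do rewrite -abse_EFin.
Qed.

(** On a box whose closure lies in G, test with the smooth approximations of its indicator:
    dominated convergence, with |g| restricted to the closed box as majorant, gives a zero integral.
    Countably many such boxes cover G. *)
Lemma fundamental_lemma (G : set 'rV[R]_n) (g : 'rV[R]_n -> R) :
  open G -> locally_integrable_rV G g ->
  (forall phi, test_function G phi -> (\int[mu]_(x in G) (g x * phi x) = 0)%R) ->
  {ae mu, forall x, G x -> g x = 0%R}.
Proof.
move=> oG lg g0; have mG := open_measurable_rV oG.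
have [D [l [r [lrG GE]]]] := open_box_cover oG.
have boxint a b : cbox a b `<=` G -> \int[mu]_(x in box a b) (g x)%:E = 0.
  move=> abG.
  have mab := measurable_cbox a b.
  have ig : mu.-integrable G ((EFin \o (fun x => `|g x|%R)) \_ (cbox a b)).
    apply/integrable_restrict => //; rewrite setIidr//.
    rewrite (_ : EFin \o _ = abse \o (EFin \o g))//; apply: integrable_abse.
    exact: locally_integrable_restrict lg mab (@compact_cbox _ _ a b) abG.
  pose f_ k x := (g x * tensor (box_approx a b k) x)%:E.
  have mf_ k : measurable_fun G (f_ k).
    apply/measurable_EFinP; apply: measurable_funM; first by case: lg.
    apply: measurable_funTS; apply: continuous_measurable_rV.
    by apply: continuous_tensor => i; exact/smooth1_continuous/smooth1_box_approx.
  have fdom k x : `|f_ k x| <= ((EFin \o (fun x => `|g x|%R)) \_ (cbox a b)) x.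
    rewrite /f_ patchE; case: ifPn => [_|].
      rewrite /= lee_fin normrM ler_piMr//.
      by have /andP[? ?] := tensor_box_approx_bound a b k x; rewrite ger0_norm.
    rewrite notin_setE => nx; suff -> : tensor (box_approx a b k) x = 0%R.
      by rewrite mulr0 abse0.
    apply/eqP; apply: contra_notT nx => /prodf_neq0 h i.
    by apply: (@box_approx_supp _ _ k); exact: h.
  have cf : \int[mu]_(x in G) f_ k x @[k --> \oo] -->
      \int[mu]_(x in G) (g x * \1_(box a b) x)%:E.
    apply: (dominated_cvg _ _ _ _ ig) => //.
    - move=> x Gx; apply: cvg_near_cst; near=> k.
      by congr (_ * _)%:E; near: k; exact: tensor_box_approx_cvg.
    - by move=> x _; rewrite patchE; case: ifPn.
  have f_0 k : \int[mu]_(x in G) f_ k x = 0.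
    have tk : test_function G (tensor (box_approx a b k)).
      apply: (@test_tensor _ _ G _ a b) => // [i|i s].
        exact: smooth1_box_approx.
      exact: box_approx_supp.
    (* [fine] also sends infinite values to 0, so the vanishing of the real integral yields that of
       the extended one only after integrability is checked. *)
    have := g0 _ tk; rewrite /Rintegral -[LHS]/(fine _) => /eqP.
    rewrite fine_eq0; last first.
      apply: integrable_fin_num => //; apply: le_integrable ig => //.
        exact: mf_.
      by move=> x Gx; apply: le_trans (fdom k x) _; exact: lee_abs.
    by move=> /eqP.
  transitivity (\int[mu]_(x in G) (g x * \1_(box a b) x)%:E).
    rewrite integral_mkcond [RHS]integral_mkcond; apply: eq_integral => x _.
    rewrite !patchE indicE; case: ifPn => xab.
      rewrite mulr1 ifT// inE; apply: abG => i.
      by move/set_mem/(_ i): xab => /andP[? ?]; rewrite !ltW.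
    by rewrite mulr0 if_same.
  have <- := cvg_lim (@ereal_hausdorff R) cf.
  by rewrite (_ : (fun k => _) = cst 0) ?lim_cst//; apply/funext => k; rewrite f_0.
rewrite GE.
suff : {ae mu, forall x, forall k, D k -> box (l k) (r k) x -> g x = 0%R}.
  apply: filterS => x h [k Dk xk]; exact: h Dk xk.
apply: ae_foralln => k.
have [Dk|nDk] := pselect (D k); last by apply: aeW.
have lkG := lrG k Dk.
have mb : measurable (box (l k) (r k)) by exact: measurable_box.
have ibox : mu.-integrable setT ((EFin \o g) \_ (box (l k) (r k))).
  apply/integrable_restrict => //; rewrite setTI.
  have := locally_integrable_restrict mG lg (measurable_cbox (l k) (r k))
    (@compact_cbox _ _ _ _) lkG.
  apply: integrableS => //; first exact: measurable_cbox.
  by move=> x xk i; have /andP[? ?] := xk i; rewrite !ltW.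
have subG a b : cbox a b `<=` cbox (l k) (r k) -> cbox a b `<=` G.
  by move=> h; exact: subset_trans lkG.
have := ae0_of_box_integrals ibox; case.
- by rewrite -integral_mkcond boxint.
- move=> a b; rewrite -integral_mkcondr boxI boxint//; apply: subG => x h i.
  have := h i; rewrite !mxE ge_max le_min => /andP[/andP[_ ->] /andP[_ ->]].
  by [].
- move=> N [mN N0 sub]; exists N; split=> // x hx; apply: sub => /=.
  apply: contra_not hx => + _ xk; rewrite patchE mem_set//= => -[].
  done.
Unshelve. all: by end_near. Qed.

End fundamental_lemma.

(** * Weak gradients: classical derivatives and uniqueness *)

Section weak_gradient_theory.
Context {R : realType} {n : nat}.
Local Notation mu := (@lebesgue_rV R n).
Implicit Types (G K : set 'rV[R]_n) (u phi : 'rV[R]_n -> R).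

Lemma ler_coord_norm (x : 'rV[R]_n) i : `|x ord0 i| <= `|x|.
Proof.
have /mapP[j Hj ->] : `|x ord0 i| \in [seq `|x k.1 k.2| | k : 'I_1 * 'I_n].
  by apply/mapP; exists (ord0, i) => //=; rewrite mem_enum.
by rewrite [leRHS]/Num.norm /= mx_normrE; apply/bigmax_geP; right => /=; exists j.
Qed.

Lemma compact_sub_box K : compact K ->
  exists2 M : R, 0 < M & K `<=` box (const_mx (- M)) (const_mx M).
Proof.
move=> /compact_bounded[N [_ hN]].
exists (`|N| + 2) => [|x Kx i]; first by rewrite ltr_wpDl.
have /(hN (`|N| + 1)) hx : N < `|N| + 1 by rewrite (le_lt_trans (ler_norm _))// ltrDl.
rewrite !mxE -ltr_norml (le_lt_trans (ler_coord_norm x i))//.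
by apply: le_lt_trans (hx _ Kx) _; rewrite ltrD2l ltr1n.
Qed.

Lemma continuous_bounded_compact K (f : 'rV[R]_n -> R) : continuous f ->
  compact K -> exists B, forall x, K x -> `|f x| <= B.
Proof.
move=> cf cK; have : compact (f @` K).
  by apply: continuous_compact => //; exact: continuous_subspaceT.
move=> /compact_bounded[N [_ hN]]; exists (`|N| + 1) => x Kx.
by apply: (hN (`|N| + 1)) => //; rewrite (le_lt_trans (ler_norm _))// ltrDl.
Qed.

Lemma test_function_facts G phi : test_function G phi ->
  exists (K : set 'rV[R]_n) (M : R),
  [/\ 0 < M, compact K /\ K `<=` G, K `<=` box (const_mx (- M)) (const_mx M),
      continuous phi /\ (forall x, ~ K x -> phi x = 0) &
      forall i, [/\ continuous (partial i phi),
        forall x, ~ K x -> partial i phi x = 0 &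
        forall x, is_derive x (delta_mx ord0 i) phi (partial i phi x)]].
Proof.
move=> [sphi cK KG]; have [M M0 KM] := compact_sub_box cK.
have out x : ~ closure [set x | phi x != 0] x -> phi x = 0.
  by apply: contra_notP => /eqP h; exact: subset_closure.
exists (closure [set x | phi x != 0]), M; split=> // [|i].
  by split=> //; case: (sphi [::]).
split.
- by case: (sphi [:: i]).
- move=> x nKx; rewrite /partial (@near_eq_derive R _ R _ (cst 0)) ?derive_cst//.
  have /open_nbhs_nbhs : open_nbhs x (~` closure [set x | phi x != 0]).
    by split => //; apply: closed_openC; exact: closed_closure.
  by apply: filterS => y /out ->.
- by move=> x; apply: DeriveDef => //; case: (sphi [::]).
Qed.

Lemma locally_integrable_continuous G f : measurable G -> continuous f ->
  locally_integrable_rV G f.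
Proof.
move=> mG cf; have mf := continuous_measurable_rV cf.
split; first exact: measurable_funTS.
move=> K cK KG; have [B hB] := continuous_bounded_compact cf cK.
have [M M0 KM] := compact_sub_box cK.
have mK := compact_measurable_rV cK.
have /integrableP[_] : mu.-integrable K (EFin \o f).
  apply: measurable_bounded_integrable => //.
  - apply: le_lt_trans (lebesgue_box_lty (const_mx (- M)) (const_mx M)).
    by apply: le_measure => //; rewrite inE//; exact: measurable_box.
  - exact: measurable_funTS.
  - exists B; split; first exact: num_real.
    by move=> C BC x Kx; apply: le_trans (hB _ Kx) (ltW BC).
by under eq_integral do rewrite /= .
Qed.

(** The sum of the two integrands is the partial derivative of u phi, which is compactly supported,
    so [integral_partial_eq0] applies. *)
Lemma classical_weak_gradient G u (w : 'rV[R]_n -> 'rV[R]_n) :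
  open G -> continuous u ->
  (forall i, continuous (fun x => w x ord0 i)) ->
  (forall i x, is_derive x (delta_mx ord0 i) u (w x ord0 i)) ->
  is_weak_gradient G u w.
Proof.
move=> oG cu cw dw i; have mG := open_measurable_rV oG.
split; first exact: locally_integrable_continuous.
move=> phi /test_function_facts[K [M [M0 [_ KG] KM [cphi phi0]]]] /(_ i)[cd d0 dphi].
have KM' x : ~ box (const_mx (- M)) (const_mx M) x -> ~ K x.
  by apply: contra_not => /KM.
have int_prod (f g : 'rV[R]_n -> R) : continuous f -> continuous g ->
    (forall x, ~ K x -> g x = 0) -> mu.-integrable setT (EFin \o (fun x => f x * g x)).
  move=> cf cg g0.
  have cfg : continuous (fun x => f x * g x) by move=> x; exact: continuousM (cf x) (cg x).
  have [B hB] := continuous_bounded_compact cfg (@compact_cbox _ _ (const_mx (- M)) (const_mx M)).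
  apply: (@integrable_bounded_box _ _ _ (const_mx (- M)) (const_mx M) `|B|).
  - exact: continuous_measurable_rV.
  - move=> x; have [xM|nx] := pselect (cbox (const_mx (- M)) (const_mx M) x).
      exact: le_trans (hB _ xM) (ler_norm _).
    rewrite g0 ?mulr0 ?normr0//; apply: contra_not nx => /KM xM j.
    by have /andP[? ?] := xM j; rewrite !ltW.
  - by move=> x /KM' /g0 ->; rewrite mulr0.
have toT (f g : 'rV[R]_n -> R) : (forall x, ~ K x -> g x = 0) ->
    \int[mu]_(x in G) (f x * g x) = \int[mu]_x (f x * g x).
  move=> g0; rewrite Rintegral_mkcond; apply: eq_Rintegral => x _.
  by rewrite patchE; case: ifPn => //; rewrite notin_setE => nG; rewrite g0 ?mulr0// => /KG.
rewrite !toT//.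
apply/eqP; rewrite -addr_eq0 -RintegralD//; [|exact: int_prod|exact: int_prod].
apply/eqP.
have cD : continuous (fun x => u x * partial i phi x + w x ord0 i * phi x).
  move=> x; apply: (@continuousD _ _ _ (fun x => u x * partial i phi x)
    (fun x => w x ord0 i * phi x)).
    exact: continuousM (cu x) (cd x).
  exact: continuousM (cw i x) (cphi x).
have [B hB] := continuous_bounded_compact cD (@compact_cbox _ _ (const_mx (- M)) (const_mx M)).
suff E : (\int[mu]_x (u x * partial i phi x + w x ord0 i * phi x)%:E = 0)%E.
  by rewrite /Rintegral E.
apply: (@integral_partial_eq0 _ _ i (fun x => u x * phi x) _ M `|B|) => //.
- exact: continuous_measurable_rV.
- move=> x; have [xM|nx] := pselect (cbox (const_mx (- M)) (const_mx M) x).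
    exact: le_trans (hB _ xM) (ler_norm _).
  rewrite d0 ?phi0 ?mulr0 ?addr0 ?normr0//; apply: contra_not nx => /KM xM j;
    by have /andP[? ?] := xM j; rewrite !ltW.
- by move=> x /KM' nK; rewrite d0 ?phi0 ?mulr0 ?addr0.
- by move=> x /KM' nK; rewrite phi0 ?mulr0.
- move=> x s; apply: (@continuous_comp _ _ _
    (fun s : R => s *: delta_mx ord0 i + x : 'rV[R]_n)
    (fun x => u x * partial i phi x + w x ord0 i * phi x)); last exact: cD.
  by apply: cvgD; [apply: cvgZr_tmp; exact: cvg_id|exact: cvg_cst].
- move=> x s; apply/(is_derive_line (fun x => u x * phi x)).
  apply: is_derive_eq (is_deriveM (dw i _) (dphi _)) _.
  by rewrite /GRing.scale/= [phi _ * _]mulrC.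
Qed.

Lemma weak_gradientP G u g : is_weak_gradient G u g ->
  is_weak_gradient G u (weak_gradient G u).
Proof. by move=> ug; rewrite /weak_gradient; case: xgetP => [_ -> //|/(_ g)]. Qed.

Lemma integrable_locally_integrableM G K g f : open G ->
  locally_integrable_rV G g -> compact K -> K `<=` G -> continuous f ->
  (forall x, ~ K x -> f x = 0) ->
  mu.-integrable G (EFin \o (fun x => g x * f x)).
Proof.
move=> oG lg cK KG cf f0; have mG := open_measurable_rV oG.
have mK := compact_measurable_rV cK.
have [B hB] := continuous_bounded_compact cf cK.
have iK : mu.-integrable K (EFin \o g).
  exact: locally_integrable_restrict lg mK cK KG.
have : mu.-integrable G ((cst B%:E \* (abse \o (EFin \o g)))%E \_ K).
  apply/integrable_restrict => //; rewrite setIidr//.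
  by apply: integrableZl => //; exact: integrable_abse.
apply: le_integrable => //.
  apply/measurable_EFinP; apply: measurable_funM; first by case: lg.
  by apply: measurable_funTS; exact: continuous_measurable_rV.
move=> x Gx; rewrite patchE; case: ifPn => [/set_mem Kx|].
  rewrite /= lee_fin !normrM normr_id mulrC ler_wpM2r//.
  exact: le_trans (hB x Kx) (ler_norm _).
by rewrite notin_setE => /f0 /= ->; rewrite mulr0.
Qed.

(** [weak_gradient] is an arbitrary choice; uniqueness is what transfers estimates for the explicit
    [cutoff_grad] to the gradient that enters the Sobolev norm. *)
Lemma weak_gradient_unique G u g h : open G ->
  is_weak_gradient G u g -> is_weak_gradient G u h ->
  {ae mu, forall x, G x -> g x = h x}.
Proof.
move=> oG gu hu; have mG := open_measurable_rV oG.
suff : {ae mu, forall x, forall i, G x -> g x ord0 i - h x ord0 i = 0}.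
  apply: filterS => x gh Gx; apply/rowP => i.
  by apply/eqP; rewrite -subr_eq0 gh.
apply: filter_forall => i.
have [lg gphi] := gu i; have [lh hphi] := hu i.
apply: (@fundamental_lemma _ _ _ (fun x => g x ord0 i - h x ord0 i)) => //.
  split; first by apply: measurable_funB; [case: lg|case: lh].
  move=> K cK KG.
  have mK := compact_measurable_rV cK.
  have ig := locally_integrable_restrict mG lg mK cK KG.
  have ih := locally_integrable_restrict mG lh mK cK KG.
  by have /integrableP[_] := integrableB mK ig ih.
move=> phi tphi.
have [K [M [M0 [cK KG] _ [cphi phi0] _]]] := test_function_facts tphi.
under eq_Rintegral do rewrite mulrBl.
rewrite RintegralB//; last 2 first.
  exact: (@integrable_locally_integrableM _ K).
  exact: (@integrable_locally_integrableM _ K).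
apply/eqP; rewrite subr_eq0 -(inj_eq oppr_inj) -gphi// -hphi//.
Qed.

End weak_gradient_theory.

(** * Euclidean cut-off functions *)

Section euclidean_theory.
Context {R : realType} {n : nat}.
Local Notation mu := (@lebesgue_rV R n).
Implicit Types (x y z : 'rV[R]_n).

Definition sqnorm x : R := \sum_i x ord0 i ^+ 2.

Lemma sqnorm_ge0 x : 0 <= sqnorm x.
Proof. by apply: sumr_ge0 => i _; exact: sqr_ge0. Qed.

Lemma euclidean_norm_ge0 x : 0 <= euclidean_norm x.
Proof. exact: sqrtr_ge0. Qed.

Lemma euclidean_norm_sqr x : euclidean_norm x ^+ 2 = sqnorm x.
Proof. by rewrite sqr_sqrtr// sqnorm_ge0. Qed.

Lemma euclidean_ballE x (r : R) : 0 < r ->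
  euclidean_ball x r = [set y | sqnorm (y - x) < r ^+ 2].
Proof.
move=> r0; apply/seteqP; split=> y; rewrite /euclidean_ball/= -euclidean_norm_sqr => h.
  by rewrite ltr_pXn2r// ?nnegrE ?euclidean_norm_ge0// ltW.
by rewrite -(@ltr_pXn2r _ 2)// ?nnegrE ?euclidean_norm_ge0// ltW.
Qed.

Lemma continuous_sqnorm x : continuous (fun y => sqnorm (y - x)).
Proof.
rewrite /sqnorm; apply: (@continuous_big R 'I_n _ 0 xpredT add_continuous) => i _ y.
rewrite (_ : (fun _ => _) = (fun s : R => (s - x ord0 i) ^+ 2) \o (fun y => y ord0 i)).
  2: by apply/funext => z; rewrite /= !mxE.
apply: continuous_comp; first exact: coord_continuous.
apply: (@continuous_comp _ _ _ (fun s : R => s - x ord0 i) (fun s => s ^+ 2)).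
  by apply: cvgB; [exact: cvg_id|exact: cvg_cst].
exact: exprn_continuous.
Qed.

Lemma open_euclidean_ball x (r : R) : 0 < r -> open (euclidean_ball x r).
Proof.
move=> r0; rewrite euclidean_ballE//.
have := @open_comp _ _ (fun y => sqnorm (y - x)) [set s | s < r ^+ 2].
by apply; [move=> y _; exact: continuous_sqnorm|exact: open_lt].
Qed.

Lemma euclidean_norm_coord x i : `|x ord0 i| <= euclidean_norm x.
Proof.
rewrite -(@ler_pXn2r _ 2)// ?nnegrE ?euclidean_norm_ge0//.
rewrite euclidean_norm_sqr real_normK ?num_real// /sqnorm (bigD1 i)//= lerDl.
by apply: sumr_ge0 => j _; exact: sqr_ge0.
Qed.

Lemma euclidean_ball_sub_box x r :
  euclidean_ball x r `<=` box (x - const_mx r) (x + const_mx r).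
Proof.
move=> y /= yr i; rewrite !mxE -ltr_distl; apply: le_lt_trans yr.
by have := euclidean_norm_coord (y - x) i; rewrite !mxE.
Qed.

Lemma euclidean_normZ (a : R) x :
  euclidean_norm (a *: x) = `|a| * euclidean_norm x.
Proof.
rewrite /euclidean_norm -sqrtr_sqr -sqrtrM ?sqr_ge0//; congr Num.sqrt.
by rewrite mulr_sumr; apply: eq_bigr => i _; rewrite mxE exprMn.
Qed.

Lemma measurable_euclidean_norm (G : set 'rV[R]_n) (g : 'rV[R]_n -> 'rV[R]_n) :
  measurable G -> (forall i, measurable_fun G (fun x => g x ord0 i)) ->
  measurable_fun G (euclidean_norm \o g).
Proof.
move=> mG mg; apply: (@measurableT_comp _ _ _ _ _ _ (@Num.sqrt R)).
  by apply: continuous_measurable_fun; exact: sqrt_continuous.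
apply: measurable_sum => i; exact: measurable_funX.
Qed.

End euclidean_theory.

Section cutoff.
Context {R : realType} {n : nat}.
Local Notation mu := (@lebesgue_rV R n).
Variables (x0 : 'rV[R]_n) (rho r : R).
Hypotheses (rho0 : 0 < rho) (rhor : rho < r).

(* The slope 3 makes the argument at most -2 outside of the ball of radius r,
   so that the derivative vanishes there too. *)
Definition cutoff_arg (z : 'rV[R]_n) : R :=
  1 - 3 / (r ^+ 2 - rho ^+ 2) * (sqnorm (z - x0) - rho ^+ 2).

Definition cutoff z := smooth_step (cutoff_arg z).

(** The 6 is the slope 3 of [cutoff_arg] times the 2 from differentiating the squared norm. *)
Definition cutoff_grad z : 'rV[R]_n :=
  (step_bump (cutoff_arg z) * - (6 / (r ^+ 2 - rho ^+ 2))) *: (z - x0).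

Let r0 : 0 < r. Proof. exact: lt_trans rhor. Qed.

Let den0 : 0 < r ^+ 2 - rho ^+ 2.
Proof. by rewrite subr_gt0 ltr_pXn2r// ?nnegrE ltW. Qed.

Lemma cutoff_in z : euclidean_ball x0 rho z -> cutoff z = 1.
Proof.
rewrite euclidean_ballE//= => zr; rewrite /cutoff smooth_step1// /cutoff_arg.
rewrite lerDl oppr_ge0 mulr_ge0_le0//; first by rewrite divr_ge0// ltW.
by rewrite subr_le0 ltW.
Qed.

Lemma cutoff_arg_out z : ~ euclidean_ball x0 r z -> cutoff_arg z <= - 2.
Proof.
rewrite euclidean_ballE//= => /negP; rewrite -leNgt => zr; rewrite /cutoff_arg.
suff : 3 <= 3 / (r ^+ 2 - rho ^+ 2) * (sqnorm (z - x0) - rho ^+ 2) by lra.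
rewrite mulrAC -mulrA ler_peMr// ler_pdivlMr// mul1r; lra.
Qed.

Lemma cutoff_out z : ~ euclidean_ball x0 r z -> cutoff z = 0.
Proof. by move=> /cutoff_arg_out h; rewrite /cutoff smooth_step0//; lra. Qed.

Lemma cutoff_grad_out z : ~ euclidean_ball x0 r z -> cutoff_grad z = 0.
Proof.
move=> /cutoff_arg_out h; rewrite /cutoff_grad step_bump0 ?mul0r ?scale0r//.
by rewrite ler0_norm; lra.
Qed.

Lemma cutoff_ge0 z : 0 <= cutoff z. Proof. exact: smooth_step_ge0. Qed.
Lemma cutoff_le1 z : cutoff z <= 1. Proof. exact: smooth_step_le1. Qed.

Lemma cutoff_grad_bound (B : R) z : (forall s, `|step_bump s| <= B) ->
  euclidean_norm (cutoff_grad z) <= 6 * B / (r - rho).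
Proof.
move=> hB; have B0 : 0 <= B by rewrite (le_trans _ (hB 0)).
have [zr|/cutoff_grad_out ->] := pselect (euclidean_ball x0 r z); last first.
  rewrite -(scale0r 0) euclidean_normZ normr0 mul0r divr_ge0 ?mulr_ge0//.
  by rewrite subr_ge0 ltW.
rewrite euclidean_normZ normrM normrN (ger0_norm (x := 6 / _)); last first.
  by rewrite divr_ge0// ltW.
(* In the ball |z - x0| < r <= r + rho, and this factor cancels against r^2 - rho^2 = (r - rho)(r +
   rho). *)
apply: (@le_trans _ _ (B * (6 / (r ^+ 2 - rho ^+ 2)) * (r + rho))).
  have c0 : 0 < 6 / (r ^+ 2 - rho ^+ 2) by rewrite divr_gt0.
  apply: ler_pM.
  - by rewrite mulr_ge0// ltW.
  - exact: euclidean_norm_ge0.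
  - by rewrite ler_pM2r.
  - by rewrite ltW// (lt_trans zr)// ltrDl.
rewrite le_eqVlt; apply/orP; left; apply/eqP; field.
by rewrite (gt_eqF den0) andbT gt_eqF ?subr_gt0.
Qed.

Lemma continuous_cutoff_arg : continuous cutoff_arg.
Proof.
move=> z; pose g (s : R) : R := 1 - 3 / (r ^+ 2 - rho ^+ 2) * (s - rho ^+ 2).
have hg : continuous g.
  move=> s; apply: cvgB; first exact: cvg_cst.
  apply: cvgM; first exact: cvg_cst.
  by apply: cvgB; [exact: cvg_id|exact: cvg_cst].
exact: (continuous_comp (@continuous_sqnorm _ _ x0 z) (hg _)).
Qed.

Lemma continuous_cutoff : continuous cutoff.
Proof.
move=> z; have h := smooth1_continuous (@smooth1_step R).
exact: (continuous_comp (@continuous_cutoff_arg z) (h _)).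
Qed.

Lemma continuous_cutoff_grad i : continuous (fun z => cutoff_grad z ord0 i).
Proof.
have h := smooth1_continuous (@smooth1_step_bump R).
rewrite (_ : (fun _ => _) = (fun z => step_bump (cutoff_arg z)) \*
    (fun z => - (6 / (r ^+ 2 - rho ^+ 2)) * (z ord0 i - x0 ord0 i))).
  2: by apply/funext => z; rewrite /= !mxE mulrA.
move=> z; apply: continuousM.
  exact: (continuous_comp (@continuous_cutoff_arg z) (h _)).
apply: continuousM; first exact: cst_continuous.
apply: continuousB; [exact: coord_continuous|exact: cst_continuous].
Qed.

Lemma is_derive_cutoff i z :
  is_derive z (delta_mx ord0 i) cutoff (cutoff_grad z ord0 i).
Proof.
rewrite -{1}[z]add0r -{1}(scale0r (delta_mx ord0 i)); apply/is_derive_line.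
pose c := \sum_(j | j != i) (z ord0 j - x0 ord0 j) ^+ 2.
have E h : sqnorm (h *: delta_mx ord0 i + z - x0) =
    (h + (z ord0 i - x0 ord0 i)) ^+ 2 + c.
  rewrite /sqnorm (bigD1 i)//=; congr (_ + _).
    by rewrite !mxE !eqxx mulr1 addrA.
  by apply: eq_bigr => j /negPf ji; rewrite !mxE eqxx ji mulr0 add0r.
pose k := 3 / (r ^+ 2 - rho ^+ 2).
pose a h : R := 1 - k * ((h + (z ord0 i - x0 ord0 i)) ^+ 2 + c - rho ^+ 2).
have -> : (fun h => cutoff (h *: delta_mx ord0 i + z)) = smooth_step \o a.
  by apply/funext => h; rewrite /cutoff /cutoff_arg E.
have a0 : a 0 = cutoff_arg z.
  by rewrite /a /cutoff_arg -E scale0r add0r.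
rewrite /cutoff_grad mxE -a0 -mulrA.
apply: is_derive1_comp; first exact: is_derive_smooth_step.
pose b := z ord0 i - x0 ord0 i.
have d1 : is_derive (0 : R) 1 (fun h : R => (h + b) ^+ 2) (2 * b).
  have ds : is_derive (0 : R) 1 (fun h : R => h + b) 1 by exact: is_derive_shift.
  rewrite (_ : (fun h : R => _) = (fun h : R => h + b) * (fun h : R => h + b)).
    2: by apply/funext => h; rewrite fctE expr2.
  apply: is_derive_eq (is_deriveM ds ds) _.
  by rewrite /GRing.scale/= add0r; ring.
have d2 := is_deriveB (is_deriveD d1 (is_derive_cst c (0 : R) 1))
  (is_derive_cst (rho ^+ 2) (0 : R) 1).
have d3 := is_deriveB (is_derive_cst (1 : R) (0 : R) 1) (is_deriveZ k d2).
rewrite (_ : a = cst 1 - k \*: ((fun h : R => (h + b) ^+ 2) + cst c - cst (rho ^+ 2)))//.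
apply: is_derive_eq d3 _.
rewrite /GRing.scale/= !mxE /k /b.
by field; rewrite gt_eqF.
Qed.

Lemma cutoff_weak_gradient G : open G -> is_weak_gradient G cutoff cutoff_grad.
Proof.
move=> oG; apply: classical_weak_gradient => //.
- exact: continuous_cutoff.
- exact: continuous_cutoff_grad.
- exact: is_derive_cutoff.
Qed.

End cutoff.

(** * The Sobolev norm of the cut-off function *)

Section cutoff_sobolev.
Context {R : realType} {n : nat}.
Local Notation mu := (@lebesgue_rV R n).
Local Open Scope ereal_scope.

Lemma euclidean_ball_lty (x : 'rV[R]_n) (r : R) (G : set 'rV[R]_n) :
  (0 < r)%R -> measurable G -> mu (euclidean_ball x r `&` G) < +oo.
Proof.
move=> r0 mG; apply: le_lt_trans (lebesgue_box_lty (x - const_mx r) (x + const_mx r)).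
apply: le_measure; rewrite ?inE.
- by apply: measurableI => //; apply: open_measurable_rV; exact: open_euclidean_ball.
- exact: measurable_box.
- by move=> y [] /euclidean_ball_sub_box.
Qed.

Lemma integral_powR_le (G A : set 'rV[R]_n) (p c : R) (f : 'rV[R]_n -> R) :
  (0 < p)%R -> measurable G -> measurable A -> mu (A `&` G) < +oo ->
  measurable_fun G f -> (forall x, `|f x| <= c)%R ->
  (forall x, ~ A x -> f x = 0%R) ->
  \int[mu]_(x in G) (`|f x| `^ p)%:E <= (c `^ p)%:E * mu (A `&` G).
Proof.
move=> p0 mG mA Aoo mf fc f0.
rewrite -integral_cst; last exact: measurableI.
rewrite integral_mkcondl; apply: ge0_le_integral => //.
- apply/measurable_EFinP; apply: (measurableT_comp (measurable_powR _)).
  exact: measurableT_comp.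
- by apply/measurable_restrict => //; exact: measurable_cst.
- move=> x _; rewrite patchE; case: ifPn => [_|].
    rewrite lee_fin; apply: ge0_ler_powR => //; rewrite ?ltW// nnegrE//.
    by rewrite (le_trans _ (fc x)).
  by rewrite notin_setE => /f0 ->; rewrite normr0 powR0 ?gt_eqF.
Qed.

Variables (G : set 'rV[R]_n) (p B : R) (x0 : 'rV[R]_n) (rho r : R).
Hypotheses (oG : open G) (p1 : (1 <= p)%R) (hB : forall s : R, (`|step_bump s| <= B)%R)
  (rho0 : (0 < rho)%R) (rhor : (rho < r)%R).

Let u := cutoff x0 rho r.
Let w := cutoff_grad x0 rho r.
Let mG := open_measurable_rV oG.
Let p0 : (0 < p)%R. Proof. exact: lt_le_trans p1. Qed.
Let r0 : (0 < r)%R. Proof. exact: lt_trans rhor. Qed.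
Let mball : measurable (euclidean_ball x0 r).
Proof. by apply: open_measurable_rV; exact: open_euclidean_ball. Qed.
Let ball_lty := @euclidean_ball_lty x0 _ G r0 mG.

Let uw := @cutoff_weak_gradient _ _ x0 _ _ rho0 rhor G oG.
Let ug := weak_gradientP uw.

Let mnorm_w : measurable_fun G (euclidean_norm \o w).
Proof. by apply: measurable_euclidean_norm => // i; case: (uw i) => -[]. Qed.

Let mnorm_g : measurable_fun G (euclidean_norm \o weak_gradient G u).
Proof. by apply: measurable_euclidean_norm => // i; case: (ug i) => -[]. Qed.

Let ae_w : ae_eq mu G (euclidean_norm \o weak_gradient G u) (euclidean_norm \o w).
Proof.
by apply: filterS (weak_gradient_unique oG ug uw) => x /= h Gx; rewrite h.
Qed.

Let mu_u : measurable_fun G u.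
Proof.
apply: measurable_funTS; apply: continuous_measurable_rV; exact: continuous_cutoff.
Qed.

Let int_u : \int[mu]_(x in G) (`|u x| `^ p)%:E <= mu (euclidean_ball x0 r `&` G).
Proof.
have := @integral_powR_le G (euclidean_ball x0 r) p 1 u p0 mG mball ball_lty mu_u.
rewrite powR1 mul1e; apply.
  by move=> x; rewrite ger0_norm ?cutoff_ge0 ?cutoff_le1.
by move=> x; exact: cutoff_out.
Qed.

Let mpow (f : 'rV[R]_n -> R) : measurable_fun G f -> measurable_fun G (fun x => (`|f x| `^ p)%:E).
Proof.
move=> mf; apply/measurable_EFinP; apply: (measurableT_comp (measurable_powR _)).
exact: measurableT_comp.
Qed.

Let int_g :
  \int[mu]_(x in G) (`|euclidean_norm (weak_gradient G u x)| `^ p)%:E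
  <= ((6 * B / (r - rho)) `^ p)%:E * mu (euclidean_ball x0 r `&` G).
Proof.
rewrite (@ge0_ae_eq_integral _ _ _ mu G _ (fun x => (`|euclidean_norm (w x)| `^ p)%:E))//.
- apply: integral_powR_le => //.
  + by move=> x; rewrite ger0_norm ?euclidean_norm_ge0// cutoff_grad_bound.
  + move=> x h; rewrite /= /w cutoff_grad_out// -(scale0r 0%R) euclidean_normZ.
    by rewrite normr0 mul0r.
- exact: mpow mnorm_g.
- exact: mpow mnorm_w.
- by apply: filterS ae_w => x /= h Gx; rewrite h.
Qed.

Lemma sobolev_cutoff : sobolev G p (cutoff x0 rho r).
Proof.
split.
- by split=> //; exact: le_lt_trans int_u _.
- split; first by apply: locally_integrable_continuous => //; exact: continuous_cutoff.
  by exists w.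
- split=> //; apply: le_lt_trans int_g _.
  by rewrite lte_mul_pinfty// lee_fin powR_ge0.
Qed.

Lemma sobolev_norm_cutoff :
  sobolev_norm G p (cutoff x0 rho r) <=
  ((1 + (6 * B / (r - rho)) `^ p)%:E * mu (euclidean_ball x0 r `&` G)) `^ p^-1.
Proof.
rewrite /sobolev_norm; apply: gt0_ler_poweR.
- by rewrite invr_ge0 ltW.
- rewrite in_itv/= leey andbT; apply: integral_ge0 => x _.
  by rewrite lee_fin addr_ge0 ?powR_ge0.
- rewrite in_itv/= leey andbT mule_ge0// lee_fin addr_ge0 ?powR_ge0//.
under eq_integral do rewrite EFinD.
rewrite ge0_integralD//.
- rewrite EFinD ge0_muleDl ?lee_fin ?powR_ge0// mul1e; apply: leeD; first exact: int_u.
  apply: le_trans int_g; rewrite le_eqVlt; apply/orP; left; apply/eqP.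
  by apply: eq_integral => x _; rewrite ger0_norm ?euclidean_norm_ge0.
- exact: mpow.
- by move=> x _; rewrite lee_fin powR_ge0.
- by apply/measurable_EFinP; exact: (measurableT_comp (measurable_powR p) mnorm_g).
Qed.

End cutoff_sobolev.

(** * Mollified averages *)

Section mollifier.
Context {R : realType} {n : nat}.
Local Notation mu := (@lebesgue_rV R n).
Implicit Types (x y z : 'rV[R]_n) (k m : nat) (i j : 'I_n) (s : R).

(** The kernel in the reflected variable 2^k (y_i - s), written in the form a * s + b to which
    [smooth1_affine] applies. *)
Definition mollifier1 y k i s : R :=
  2 ^+ k * step_bump (- 2 ^+ k * s + 2 ^+ k * y ord0 i).

Definition mollifier1_step y k i s : R :=
  smooth_step (- 2 ^+ k * s + 2 ^+ k * y ord0 i).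

Lemma smooth1_mollifier1 y k i : smooth1 (mollifier1 y k i).
Proof.
apply: smooth1M; first exact: smooth1_cst.
exact/smooth1_affine/smooth1_step_bump.
Qed.

Lemma is_derive_mollifier1_step y k i s :
  is_derive s 1 (mollifier1_step y k i) (- mollifier1 y k i s).
Proof.
rewrite /mollifier1 -mulNr mulrC.
apply: (@is_derive1_comp _ smooth_step (fun s => - 2 ^+ k * s + 2 ^+ k * y ord0 i) s
  (step_bump (- 2 ^+ k * s + 2 ^+ k * y ord0 i)) (- 2 ^+ k)).
  exact: is_derive_smooth_step.
have := is_deriveD (is_deriveZ (- 2 ^+ k) (is_derive_id s (1 : R)))
  (is_derive_cst (2 ^+ k * y ord0 i) s 1).
by move=> h; apply: is_derive_eq h _; rewrite addr0 /GRing.scale/= mulr1.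
Qed.

Lemma mollifier1_arg y k i s : ~~ (y ord0 i - 2 ^- k <= s <= y ord0 i + 2 ^- k) ->
  1 < `|- 2 ^+ k * s + 2 ^+ k * y ord0 i|.
Proof.
rewrite -ler_distl -ltNge distrC => h.
have -> : - 2 ^+ k * s + 2 ^+ k * y ord0 i = 2 ^+ k * (y ord0 i - s) by ring.
rewrite normrM.
have p0 : 0 < 2 ^+ k :> R by rewrite exprn_gt0.
rewrite ger0_norm ?(ltW p0)//.
by rewrite -ltr_pdivrMl// mulr1.
Qed.

Lemma mollifier1_supp y k i s :
  mollifier1 y k i s != 0 -> y ord0 i - 2 ^- k <= s <= y ord0 i + 2 ^- k.
Proof.
apply: contra_neqT => /mollifier1_arg h.
by rewrite /mollifier1 step_bump0 ?mulr0.
Qed.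

(* The scale of the product kernel is halved one coordinate at a time: each
   change is the partial derivative of the compactly supported flux below. *)
Definition mollifier_mix y k m i : R -> R :=
  if (i < m)%N then mollifier1 y k.+1 i else mollifier1 y k i.

Definition mollifier_flux y k i j : R -> R :=
  if j == i then (fun s => mollifier1_step y k j s - mollifier1_step y k.+1 j s)
  else mollifier_mix y k i j.

Definition mollifier y k : 'rV[R]_n -> R := tensor (mollifier1 y k).

Lemma smooth1_mollifier_mix y k m i : smooth1 (mollifier_mix y k m i).
Proof. by rewrite /mollifier_mix; case: ifP => _; exact: smooth1_mollifier1. Qed.

Lemma smooth1_mollifier_flux y k i j : smooth1 (mollifier_flux y k i j).
Proof.
rewrite /mollifier_flux; case: ifP => _; last exact: smooth1_mollifier_mix.
rewrite (_ : (fun s => _) = (fun s => mollifier1_step y k j s +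
    -1 * mollifier1_step y k.+1 j s)).
  2: by apply/funext => s; rewrite mulN1r.
apply: smooth1D; first exact/smooth1_affine/smooth1_step.
by apply: smooth1M; [exact: smooth1_cst|exact/smooth1_affine/smooth1_step].
Qed.

Lemma partial_mollifier_flux y k i x :
  partial i (tensor (mollifier_flux y k i)) x =
  tensor (mollifier_mix y k i.+1) x - tensor (mollifier_mix y k i) x.
Proof.
have d s : is_derive s 1 (mollifier_flux y k i i)
    (mollifier1 y k.+1 i s - mollifier1 y k i s).
  rewrite /mollifier_flux eqxx.
  apply: is_derive_eq (is_deriveB (is_derive_mollifier1_step y k i s)
    (is_derive_mollifier1_step y k.+1 i s)) _.
  by rewrite opprK addrC.
case: (is_derive_tensor x d) => _; rewrite /partial => ->.
rewrite /tensor (bigD1 i)//= [X in _ = X - _](bigD1 i)//= [X in _ = _ - X](bigD1 i)//=.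
rewrite eqxx {1 3}/mollifier_mix ltnS leqnn ltnn mulrBl; congr (_ - _); congr (_ * _).
  apply: eq_bigr => j ji; rewrite (negPf ji) /mollifier_flux (negPf ji) /mollifier_mix.
  by rewrite ltnS [(j <= i)%N]leq_eqVlt (negPf ji : (j == i :> nat) = false).
by apply: eq_bigr => j ji; rewrite (negPf ji) /mollifier_flux (negPf ji).
Qed.

Lemma mollifier_mix0 y k : tensor (mollifier_mix y k 0) = mollifier y k.
Proof. by []. Qed.

Lemma mollifier_mixn y k : tensor (mollifier_mix y k n) = mollifier y k.+1.
Proof.
by apply/funext => x; apply: eq_bigr => i _; rewrite /mollifier_mix ltn_ord.
Qed.

(** Twice as wide as the closed support of the kernels, so that an open box contains it. *)
Definition mcube y k : set 'rV[R]_n :=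
  box (y - const_mx (2 * 2 ^- k)) (y + const_mx (2 * 2 ^- k)).

Lemma mcube_supp y k (b : 'I_n -> R -> R) x :
  (forall i s, b i s != 0 -> y ord0 i - 2 ^- k <= s <= y ord0 i + 2 ^- k) ->
  tensor b x != 0 -> mcube y k x.
Proof.
move=> hb /prodf_neq0 bx i; rewrite !mxE -ltr_distl.
have := hb i _ (bx i isT); rewrite -ler_distl => h; apply: le_lt_trans h _.
by rewrite ltr_pMl ?invr_gt0 ?exprn_gt0// ltr1n.
Qed.

Lemma le_exprV2 k : 2 ^- k.+1 <= 2 ^- k :> R.
Proof. by rewrite lef_pV2 ?posrE ?exprn_gt0// ler_eXn2l// ltr1n. Qed.

Lemma widen_scale y k i s : y ord0 i - 2 ^- k.+1 <= s <= y ord0 i + 2 ^- k.+1 ->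
  y ord0 i - 2 ^- k <= s <= y ord0 i + 2 ^- k.
Proof. by rewrite -!ler_distl => /le_trans; apply; exact: le_exprV2. Qed.

Lemma mollifier_mix_supp y k m i s : mollifier_mix y k m i s != 0 ->
  y ord0 i - 2 ^- k <= s <= y ord0 i + 2 ^- k.
Proof.
rewrite /mollifier_mix; case: ifP => _ /mollifier1_supp //; exact: widen_scale.
Qed.

(** Away from y_i the primitive no longer depends on k. The difference of two primitives in
    [mollifier_flux] therefore has compact support, although neither of them does. *)
Lemma mollifier1_step_out y k i s :
  ~~ (y ord0 i - 2 ^- k <= s <= y ord0 i + 2 ^- k) ->
  mollifier1_step y k i s = (s < y ord0 i)%R%:R.
Proof.
move=> h; have := mollifier1_arg h; rewrite /mollifier1_step.
have -> : - 2 ^+ k * s + 2 ^+ k * y ord0 i = 2 ^+ k * (y ord0 i - s) by ring.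
have p0 : 0 < 2 ^+ k :> R by rewrite exprn_gt0.
rewrite normrM (ger0_norm (ltW p0)).
have [sy|ys] := ltP s (y ord0 i).
  rewrite (@ger0_norm _ (_ - s)) ?subr_ge0 ?ltW// => h1.
  by rewrite smooth_step1// ltW.
rewrite ler0_norm ?subr_le0// mulrN => h1.
by rewrite smooth_step0// lerNr ltW.
Qed.

Lemma mollifier_flux_supp y k i j s : mollifier_flux y k i j s != 0 ->
  y ord0 j - 2 ^- k <= s <= y ord0 j + 2 ^- k.
Proof.
rewrite /mollifier_flux; case: ifP => _; last exact: mollifier_mix_supp.
apply: contra_neqT => h; rewrite !mollifier1_step_out ?subrr//.
by apply: contra h; exact: widen_scale.
Qed.

Lemma mollifier1_bound (B : R) y k i s : (forall s : R, `|step_bump s| <= B) ->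
  `|mollifier1 y k i s| <= 2 ^+ k * B.
Proof. by move=> hB; rewrite normrM ger0_norm ?exprn_ge0// ler_pM2l ?exprn_gt0. Qed.

Lemma mollifier_mix_bound (B : R) y k m i s : (forall s : R, `|step_bump s| <= B) ->
  `|mollifier_mix y k m i s| <= 2 ^+ k.+1 * B.
Proof.
move=> hB; have B0 : 0 <= B by rewrite (le_trans _ (hB 0)).
rewrite /mollifier_mix; case: ifP => _; first exact: mollifier1_bound.
apply: le_trans (mollifier1_bound y k i s hB) _.
by rewrite ler_wpM2r// ler_eXn2l// ltr1n.
Qed.

Lemma tensor_bound (c : R) (b : 'I_n -> R -> R) x : 0 <= c ->
  (forall i s, `|b i s| <= c) -> `|tensor b x| <= c ^+ n.
Proof.
move=> c0 bc; rewrite /tensor normr_prod -[n in _ ^+ n]card_ord -prodr_const.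
by apply: ler_prod => i _; rewrite normr_ge0 bc.
Qed.

(** The i-th factor is a difference of values in [0, 1], hence at most 1 <= 2 B = 2^(k+1) B 2^-k,
    whereas the others are of size 2^(k+1) B. This is the gain of one power of 2^k over the
    mollifier itself. *)
Lemma mollifier_flux_bound (B : R) y k i x : (forall s : R, `|step_bump s| <= B) ->
  1 <= B -> `|tensor (mollifier_flux y k i) x| <= (2 ^+ k.+1 * B) ^+ n * 2 ^- k.
Proof.
move=> hB B1; have B0 : 0 <= B by rewrite (le_trans ler01).
have c1 : 0 <= 2 ^+ k.+1 * B by rewrite mulr_ge0// exprn_ge0.
rewrite /tensor normr_prod (bigD1 i)//=.
have -> : (2 ^+ k.+1 * B) ^+ n * 2 ^- k =
    (2 ^+ k.+1 * B * 2 ^- k) * \prod_(j < n | j != i) (2 ^+ k.+1 * B).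
  rewrite -[n in LHS]card_ord -prodr_const (bigD1 i)//=; ring.
apply: ler_pM => //; first by rewrite prodr_ge0.
  rewrite /mollifier_flux eqxx (@le_trans _ _ 1)//.
    rewrite ler_norml; have := smooth_step_ge0; have := smooth_step_le1.
    rewrite /mollifier1_step => h1 h0.
    by apply/andP; split; [rewrite lerBrDr (le_trans _ (h0 _ _))// addrC subr_le0 h1
      |rewrite lerBlDr (le_trans (h1 _ _))// lerDl h0].
  have -> : 2 ^+ k.+1 * B * 2 ^- k = 2 * B.
    by rewrite exprS mulrAC -(mulrA 2) mulfV ?mulr1// gt_eqF// exprn_gt0.
  lra.
apply: ler_prod => j ji; rewrite normr_ge0 /mollifier_flux (negPf ji).
exact: mollifier_mix_bound.
Qed.

Lemma test_mollifier_flux y k i :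
  test_function setT (tensor (mollifier_flux y k i)).
Proof.
apply: (@test_tensor _ _ setT _ (y - const_mx (2 ^- k)) (y + const_mx (2 ^- k))) => //.
  by move=> j; exact: smooth1_mollifier_flux.
by move=> j s /mollifier_flux_supp; rewrite !mxE.
Qed.

End mollifier.

(** * Integrals of tensor products *)

Section tensor_integral.
Context {R : realType}.
Local Open Scope ereal_scope.

Lemma tensor_bounded n (b : 'I_n -> R -> R) (l r : 'rV[R]_n) :
  (forall i, continuous (b i)) ->
  (forall i s, b i s != 0%R -> (l ord0 i <= s <= r ord0 i)%R) ->
  exists B : R, forall x, (`|tensor b x| <= B)%R.
Proof.
move=> cb lr; have ct := continuous_tensor cb.
have [B hB] := continuous_bounded_compact ct (@compact_cbox _ _ l r).
exists `|B|%R => x; have [->|h] := eqVneq (tensor b x) 0%R; first by rewrite normr0.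
apply: le_trans (hB _ _) (ler_norm _) => i; apply: lr.
by move/prodf_neq0 : h; exact.
Qed.

Lemma integrable_tensor n (b : 'I_n -> R -> R) (l r : 'rV[R]_n) :
  (forall i, continuous (b i)) ->
  (forall i s, b i s != 0%R -> (l ord0 i <= s <= r ord0 i)%R) ->
  (lebesgue_rV n).-integrable setT (EFin \o tensor b).
Proof.
move=> cb lr; have ct := continuous_tensor cb; have [B hB] := tensor_bounded cb lr.
apply: (@integrable_bounded_box _ _ _ (l - const_mx 1)%R (r + const_mx 1)%R B) => //.
  exact: continuous_measurable_rV.
move=> x nx; apply/eqP; apply: contra_notT nx => /prodf_neq0 h i.
by have /andP[h1 h2] := lr i _ (h i isT); rewrite !mxE; apply/andP; split; lra.
Qed.

Lemma integral_tensor n (b : 'I_n -> R -> R) (c : 'I_n -> R) (l r : 'rV[R]_n) :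
  (forall i, continuous (b i)) ->
  (forall i s, b i s != 0%R -> (l ord0 i <= s <= r ord0 i)%R) ->
  (forall i, \int[lebesgue_measure]_s (b i s)%:E = (c i)%:E) ->
  \int[lebesgue_rV n]_x (tensor b x)%:E = (\prod_i c i)%:E.
Proof.
elim: n b c l r => [|n IH] b c l r cb lr bc.
  under eq_integral do rewrite /tensor big_ord0.
  by rewrite integral_cst// big_ord0 mul1e /= diracT.
have it := integrable_tensor cb lr.
rewrite integral_rV_cons// -(integral12_prod_meas1 (integrable_rV_cons it)).
have E a v : tensor b (rV_cons (a, v)) = (b ord0 a * tensor (fun j => b (lift ord0 j)) v)%R.
  rewrite /tensor big_ord_recl !mxE unlift_none; congr (_ * _)%R.
  by apply: eq_bigr => i _; rewrite !mxE liftK.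
have lr' i s : b (lift ord0 i) s != 0%R ->
    ((\row_j l ord0 (lift ord0 j)) ord0 i <= s <= (\row_j r ord0 (lift ord0 j)) ord0 i)%R.
  by move=> /lr; rewrite !mxE.
transitivity (\int[lebesgue_measure]_a ((\prod_(j < n) c (lift ord0 j))%:E * (b ord0 a)%:E)).
  apply: eq_integral => a _; rewrite /fubini_F/=.
  under eq_integral do rewrite E EFinM.
  rewrite integralZl//; last exact: (integrable_tensor (fun i => cb _) lr').
  by rewrite (IH _ (fun j => c (lift ord0 j)) _ _ (fun i => cb _) lr')// muleC.
rewrite integralZl//.
  by rewrite bc big_ord_recl muleC EFinM.
apply/integrableP; split.
  by apply/measurable_EFinP; apply: continuous_measurable_fun; exact: cb.
(* A single factor is bounded by viewing it as a tensor product in dimension 1. *)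
have [B hB] : exists B : R, forall s, (`|b ord0 s| <= B)%R.
  have [|i s h|B hB] := @tensor_bounded 1 (fun=> b ord0)
    (const_mx (l ord0 ord0)) (const_mx (r ord0 ord0)) => //.
    by rewrite !mxE; exact: lr.
  exists B => s; have := hB (const_mx s).
  by rewrite /tensor big_ord1 mxE.
apply: (@le_lt_trans _ _ (\int[lebesgue_measure]_(s in `[l ord0 ord0, r ord0 ord0]) (B)%:E)).
  rewrite [leRHS]integral_mkcond; apply: ge0_le_integral => //.
  - by apply/measurable_EFinP; apply: measurableT_comp => //; exact: continuous_measurable_fun.
  - by apply/(measurable_restrictT _ _).1 => //; exact: measurable_cst.
  move=> s _; rewrite patchE; case: ifPn => [_|]; first by rewrite lee_fin.
  rewrite notin_setE/= in_itv/= => h; have [->|/lr //] := eqVneq (b ord0 s) 0%R.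
  by rewrite normr0.
rewrite integral_cst//=; have := lebesgue_measure_itv `[l ord0 ord0, r ord0 ord0].
rewrite /= => ->; case: ifP => _; last by rewrite mule0.
by rewrite -EFinB -EFinM ltry.
Qed.

Lemma integral_mollifier n (y : 'rV[R]_n) k :
  \int[lebesgue_rV n]_x (mollifier y k x)%:E = 1.
Proof.
rewrite (@integral_tensor _ _ (fun=> 1%R) (y - const_mx (2 ^- k))%R (y + const_mx (2 ^- k))%R).
- by rewrite big1.
- by move=> i; exact/smooth1_continuous/smooth1_mollifier1.
- by move=> i s /mollifier1_supp; rewrite !mxE.
move=> i; have p0 : (0 < 2 ^- k :> R)%R by rewrite invr_gt0 exprn_gt0.
have p2 : (2 ^- k < 2 * 2 ^- k :> R)%R by rewrite ltr_pMl// ltr1n.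
have out (s : R) : ~~ (y ord0 i - 2 * 2 ^- k < s < y ord0 i + 2 * 2 ^- k)%R ->
    ~~ (y ord0 i - 2 ^- k <= s <= y ord0 i + 2 ^- k)%R.
  by rewrite -ltr_distl -ler_distl; apply: contra => /le_lt_trans; apply.
have d (s : R) : is_derive s 1%R (fun s => - mollifier1_step y k i s)%R (mollifier1 y k i s).
  by apply: is_derive_eq (is_deriveN (is_derive_mollifier1_step y k i s)) _; rewrite opprK.
(* The doubled interval has its endpoints strictly outside of the closed support, where
   [mollifier1_step_out] evaluates the primitive. *)
rewrite (@integral_derive_compact _ _ _ (y ord0 i - 2 * 2 ^- k)%R (y ord0 i + 2 * 2 ^- k)%R d).
- rewrite !mollifier1_step_out; [|by apply: out; rewrite ltxx ?andbF..].
  rewrite ltrBlDr ltrDl ltNge lerDl (lt_trans p0 p2) ltW ?(lt_trans p0 p2)//=.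
  by rewrite oppr0 sub0r opprK.
- exact/smooth1_continuous/smooth1_mollifier1.
- move=> s /out h; apply/eqP; apply: contraTT h => /mollifier1_supp.
  by move=> ->.
- by rewrite ltrBlDr -addrA ltrDl addr_gt0// mulr_gt0.
Qed.

End tensor_integral.

(** * Increments of the mollified averages *)

Section mollified_average.
Context {R : realType} {n : nat}.
Local Notation mu := (@lebesgue_rV R n).
Local Open Scope ereal_scope.

Lemma measurable_mcube (y : 'rV[R]_n) k : measurable (mcube y k).
Proof. exact: measurable_box. Qed.

Lemma lebesgue_mcube (y : 'rV[R]_n) k : mu (mcube y k) = ((4 * 2 ^- k) ^+ n)%:E.
Proof.
have p0 : (0 < 2 ^- k :> R)%R by rewrite invr_gt0 exprn_gt0.
rewrite lebesgue_box => [|i]; last by rewrite !mxE; lra.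
have -> : ((4 * 2 ^- k) ^+ n = \prod_(i < n) (4 * 2 ^- k) :> R)%R.
  by rewrite prodr_const card_ord.
by congr EFin; apply: eq_bigr => i _; rewrite !mxE; ring.
Qed.

Lemma integrable_locally_integrable_tensor (h : 'rV[R]_n -> R) b (l r : 'rV[R]_n) :
  locally_integrable_rV setT h -> (forall i, smooth1 (b i)) ->
  (forall i s, b i s != 0%R -> (l ord0 i <= s <= r ord0 i)%R) ->
  mu.-integrable setT (EFin \o (fun z => h z * tensor b z)%R).
Proof.
move=> lh sb lr.
apply: (@integrable_locally_integrableM _ _ _ (cbox l r)) => //.
- exact: openT.
- exact: compact_cbox.
- by apply: continuous_tensor => i; exact: smooth1_continuous.
- move=> x nx; apply/eqP; apply: contra_notT nx => /prodf_neq0 h0 i.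
  by apply: lr; exact: h0.
Qed.

Variables (v : 'rV[R]_n -> R) (g : 'rV[R]_n -> 'rV[R]_n).
Hypotheses (lv : locally_integrable_rV setT v) (vg : is_weak_gradient setT v g).

Definition mavg (y : 'rV[R]_n) (k : nat) : R :=
  (\int[mu]_z (v z * mollifier y k z))%R.

Lemma mavg_cst (A : set 'rV[R]_n) y k : measurable A ->
  (cbox (y - const_mx (2 ^- k)) (y + const_mx (2 ^- k)))%R `<=` A ->
  {ae mu, forall z, A z -> v z = 1%R} -> mavg y k = 1%R.
Proof.
move=> mA QA v1; rewrite /mavg /Rintegral.
have sm := smooth1_mollifier1 y k.
have cm := continuous_measurable_rV (continuous_tensor (fun i => smooth1_continuous (sm i))).
rewrite (ae_eq_integral (EFin \o mollifier y k))//.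
- by rewrite integral_mollifier.
- by apply/measurable_EFinP; apply: measurable_funM => //; case: lv.
- exact/measurable_EFinP.
- apply: filterS v1 => z h _; congr (_%:E).
  have [->|mz] := eqVneq (mollifier y k z) 0%R; first by rewrite mulr0.
  rewrite h ?mul1r//; apply: QA => i; rewrite !mxE.
  by apply: mollifier1_supp; move/prodf_neq0: mz; exact.
Qed.

(** Telescoping over the mixed kernels writes the increment as n integrals of v against the i-th
    derivative of the i-th flux. Each flux is a test function, so the definition of the weak
    gradient applies to it directly. *)
Lemma mavg_step y k : (mavg y k.+1 - mavg y k =
  - \sum_i \int[mu]_z (g z ord0 i * tensor (mollifier_flux y k i) z))%R.
Proof.
have int_mix m : mu.-integrable setT (EFin \o (fun z => v z * tensor (mollifier_mix y k m) z)%R).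
  apply: (@integrable_locally_integrable_tensor _ _
      (y - const_mx (2 ^- k))%R (y + const_mx (2 ^- k))%R) => //.
    by move=> i; exact: smooth1_mollifier_mix.
  by move=> i s /mollifier_mix_supp; rewrite !mxE.
rewrite /mavg -mollifier_mixn -mollifier_mix0.
rewrite -sumrN -(@telescope_sumr _ 0 n
  (fun m => \int[mu]_z (v z * tensor (mollifier_mix y k m) z))%R)//.
rewrite big_mkord; apply: eq_bigr => i _.
rewrite -RintegralB//.
have [_ /(_ _ (test_mollifier_flux y k i)) <-] := vg i.
by apply: eq_Rintegral => z _; rewrite partial_mollifier_flux mulrBr.
Qed.

Lemma le_integral_kernel (f T h : 'rV[R]_n -> R) (c : R) y k :
  mu.-integrable setT (EFin \o (fun z => f z * T z)%R) -> (0 <= c)%R ->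
  measurable_fun setT h ->
  (forall z, `|f z| <= `|h z|)%R -> (forall z, `|T z| <= c)%R ->
  (forall z, T z != 0%R -> mcube y k z) ->
  (`|\int[mu]_z (f z * T z)|%R)%:E <=
  c%:E * \int[mu]_(z in mcube y k) (`|h z|)%:E.
Proof.
move=> ifT c0 mh fh Tc Tk; have mk := measurable_mcube y k.
rewrite EFin_normr_Rintegral//; apply: le_trans (le_abse_integral _ _ _) _ => //.
  by case/integrableP: ifT.
have mnh : measurable_fun (mcube y k) (fun z => (`|h z|%R)%:E).
  by apply/measurable_EFinP; apply: measurable_funTS; exact: measurableT_comp.
rewrite -ge0_integralZl//.
rewrite [leRHS]integral_mkcond; apply: ge0_le_integral => //.
- by apply: measurableT_comp => //; case/integrableP: ifT.
- apply/(measurable_restrictT _ _).1 => //.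
  exact: measurable_funeM.
move=> z _; rewrite patchE; case: ifPn => [_|].
  by rewrite /= -EFinM lee_fin normrM mulrC ler_pM.
rewrite notin_setE => nz; have [->|/Tk //] := eqVneq (T z) 0%R.
by rewrite mulr0 abse0.
Qed.

Variable B : R.
Hypotheses (hB : forall s : R, (`|step_bump s| <= B)%R) (B1 : (1 <= B)%R).

Lemma mavg_step_bound y k :
  measurable_fun setT (euclidean_norm \o g) ->
  (`|mavg y k.+1 - mavg y k|%R)%:E <=
  (n%:R * ((2 ^+ k.+1 * B) ^+ n * 2 ^- k))%:E *
    \int[mu]_(z in mcube y k) (`|euclidean_norm (g z)|)%:E.
Proof.
move=> mg; rewrite mavg_step normrN.
have B0 : (0 <= B)%R by rewrite (le_trans ler01).
pose c : R := ((2 ^+ k.+1 * B) ^+ n * 2 ^- k)%R.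
have c0 : (0 <= c)%R by rewrite /c mulr_ge0 ?exprn_ge0 ?mulr_ge0 ?invr_ge0 ?exprn_ge0.
apply: (@le_trans _ _ (\sum_(i < n)
    (c%:E * \int[mu]_(z in mcube y k) (`|euclidean_norm (g z)|)%:E))).
  apply: (@le_trans _ _ (\sum_(i < n)
      (`|\int[mu]_z (g z ord0 i * tensor (mollifier_flux y k i) z)|%R)%:E)).
    by rewrite sumEFin lee_fin ler_norm_sum.
  apply: lee_sum => i _.
  apply: (@le_integral_kernel (fun z => g z ord0 i) _ (euclidean_norm \o g)) => //.
  - apply: (@integrable_locally_integrable_tensor _ _
      (y - const_mx (2 ^- k))%R (y + const_mx (2 ^- k))%R) => //.
    + by case: (vg i).
    + by move=> j; exact: smooth1_mollifier_flux.
    + by move=> j s /mollifier_flux_supp; rewrite !mxE.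
  - by move=> z /=; rewrite [leRHS]ger0_norm ?euclidean_norm_ge0// euclidean_norm_coord.
  - by move=> z; exact: mollifier_flux_bound.
  - by move=> z; apply: mcube_supp => j s; exact: mollifier_flux_supp.
by rewrite sumr_const card_ord [X in _ <= X * _]EFinM -[leRHS]muleA mule_natl.
Qed.

Lemma mavg0_bound y :
  (`|mavg y 0|%R)%:E <=
  ((2 * B) ^+ n)%:E * \int[mu]_(z in mcube y 0) (`|v z|)%:E.
Proof.
have B0 : (0 <= B)%R by rewrite (le_trans ler01).
apply: le_integral_kernel => //.
- apply: (@integrable_locally_integrable_tensor _ _ (y - const_mx (2 ^- 0))%R (y + const_mx (2 ^- 0))%R) => //.
  + by move=> j; exact: smooth1_mollifier1.
  + by move=> j s /mollifier1_supp; rewrite !mxE.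
- by rewrite exprn_ge0// mulr_ge0.
- by case: lv.
- move=> z; apply: tensor_bound; first by rewrite mulr_ge0.
  move=> i s; apply: le_trans (mollifier1_bound y 0 i s hB) _.
  by rewrite expr0 ler_wpM2r// ler1n.
- by move=> z; apply: mcube_supp => j s; exact: mollifier1_supp.
Qed.

End mollified_average.

(** * A weak-type Sobolev inequality *)

Section power_estimates.
Context {R : realType} {n : nat}.
Local Notation mu := (@lebesgue_rV R n).
(** Either a <= l, or a/l >= 1 and then a/l <= (a/l)^q. Integrated, this serves as the inequality of
    Jensen up to a constant, with q = 1 included. *)
Lemma le_split_powR (q a l : R) : 1 <= q -> 0 <= a -> 0 < l ->
  a <= l + l / l `^ q * a `^ q.
Proof.
move=> q1 a0 l0; have lq : 0 <= l / l `^ q by rewrite divr_ge0 ?powR_ge0// ltW.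
have [al|la] := leP a l; first by rewrite ler_wpDr// mulr_ge0 ?powR_ge0.
rewrite ler_wpDl ?(ltW l0)//.
have al1 : 1 <= a / l by rewrite ler_pdivlMr// mul1r ltW.
have lV : (l `^ q)^-1 = (l^-1) `^ q.
  by rewrite -powRN -(powR_inv1 (ltW l0)) -powRrM mulN1r.
have lV0 : 0 <= l^-1 by rewrite invr_ge0 ltW.
rewrite lV -mulrA -(powRM q lV0 a0) mulrC -ler_pdivrMr// (mulrC l^-1).
exact: le1r_powR.
Qed.

Local Open Scope ereal_scope.

(** Integrate [le_split_powR] over the cube at the level l for which the constant term contributes
    exactly e/2; the other half of e must come from the integral of |h|^q. The 8 arises from 2^(k+1)
    times the side 4 2^-k. *)
Lemma mcube_power_bound (h : 'rV[R]_n -> R) (q e B : R) (y : 'rV[R]_n) k :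
  (0 < n)%N -> (1 <= q)%R -> (0 < e)%R -> (1 <= B)%R -> measurable_fun setT h ->
  e%:E <= (n%:R * ((2 ^+ k.+1 * B) ^+ n * 2 ^- k))%:E *
    \int[mu]_(z in mcube y k) (`|h z|)%:E ->
  ((e * 2 ^+ k / (2 * (n%:R * (8 * B) ^+ n))) `^ q)%:E * mu (mcube y k) <=
    \int[mu]_(z in mcube y k) (`|h z| `^ q)%:E.
Proof.
move=> n0 q1 e0 B1 mh he; have mk := measurable_mcube y k.
have B0 : (0 < B)%R := lt_le_trans ltr01 B1.
set I := (X in _ <= X).
have I0 : 0 <= I by apply: integral_ge0 => z _; rewrite lee_fin powR_ge0.
pose K0 : R := (n%:R * (8 * B) ^+ n)%R.
have n0R : (0 < n%:R :> R)%R by rewrite ltr0n.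
have K00 : (0 < K0)%R by rewrite mulr_gt0// exprn_gt0// mulr_gt0.
pose l : R := (e * 2 ^+ k / (2 * K0))%R; rewrite -/K0 -/l.
have p0 : (0 < 2 ^+ k :> R)%R by rewrite exprn_gt0.
have l0 : (0 < l)%R := divr_gt0 (mulr_gt0 e0 p0) (mulr_gt0 (ltr0Sn R 1) K00).
have [Ioo|] := ltP I +oo; last by rewrite leye_eq => /eqP ->; rewrite leey.
have lq : (0 <= l / l `^ q)%R by rewrite divr_ge0 ?powR_ge0 ?(ltW l0).
have hb : \int[mu]_(z in mcube y k) (`|h z|)%:E <=
    l%:E * mu (mcube y k) + (l / l `^ q)%:E * I.
  have mpow : measurable_fun (mcube y k) (fun z => (`|h z| `^ q)%:E).
    apply/measurable_EFinP; apply: (measurableT_comp (measurable_powR q)).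
    by apply: measurableT_comp => //; exact: measurable_funTS.
  rewrite -integral_cst// -ge0_integralZl//.
  rewrite -ge0_integralD//.
  - apply: ge0_le_integral => //.
    + by apply/measurable_EFinP; apply: measurableT_comp => //; exact: measurable_funTS.
    + by apply: emeasurable_funD => //; exact: measurable_funeM.
    + move=> z _; rewrite -EFinM -EFinD lee_fin; exact: le_split_powR.
  - by move=> z _; rewrite lee_fin ltW.
  - by move=> z _; rewrite mule_ge0// lee_fin powR_ge0.
  - exact: measurable_funeM.
have [m Im] : exists m : R, I = m%:E by exists (fine I); rewrite fineK// ge0_fin_numE.
rewrite Im lebesgue_mcube in hb *; rewrite -EFinM lee_fin.
have m0 : (0 <= m)%R by rewrite -lee_fin -Im.
set c := (n%:R * _)%R in he.
have c0 : (0 <= c)%R.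
  by rewrite /c !mulr_ge0 ?exprn_ge0 ?mulr_ge0 ?invr_ge0 ?exprn_ge0// ltW.
have c0E : 0 <= c%:E by rewrite lee_fin.
have := le_trans he (lee_wpmul2l c0E hb).
rewrite -(EFinM l) -(EFinM (l / _)) -EFinD -EFinM lee_fin.
have d0 : (0 < 4 * 2 ^- k :> R)%R by rewrite mulr_gt0// invr_gt0.
have cl : (c * (4 * 2 ^- k) ^+ n * l = e / 2)%R.
  have -> : (c * (4 * 2 ^- k) ^+ n = K0 * 2 ^- k)%R.
    rewrite /c /K0 -!mulrA; congr (_ * _)%R; rewrite mulrC -mulrA -exprMn mulrC.
    by congr (_ ^+ _ * _)%R; rewrite exprS; field; rewrite gt_eqF.
  by rewrite /l; field; rewrite !gt_eqF.
have lq0 : (0 < l `^ q)%R by rewrite powR_gt0.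
have cpos : (0 < c)%R.
  by rewrite lt_neqAle c0 andbT; apply/eqP => c00; move: cl; rewrite -c00; lra.
move: cl l0 lq0 cpos; clear; clearbody c l => cl l0 lq0 cpos.
rewrite mulrDr (_ : c * (l * (4 * 2 ^- k) ^+ n) = e / 2)%R; last by rewrite -cl; ring.
move=> H; have {}H : (c * (4 * 2 ^- k) ^+ n * l <= c * (l / l `^ q * m))%R by rewrite cl; lra.
move: H; rewrite -(mulrA c) (ler_pM2l cpos) (mulrC _ l) -(mulrA l) (ler_pM2l l0).
by rewrite (mulrC _ m) ler_pdivlMr// mulrC.
Qed.

(** Chebyshev followed by Tonelli: z lies in the cube around y exactly when y lies in the cube
    around z, so each z is counted with the volume of a cube as weight. *)
Lemma mcube_fubini (h : 'rV[R]_n -> \bar R) (L : R) k :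
  measurable_fun setT h -> (forall z, 0 <= h z) -> (0 <= L)%R ->
  let S := [set y | L%:E <= \int[mu]_(z in mcube y k) h z] in
  measurable S /\ L%:E * mu S <= ((4 * 2 ^- k) ^+ n)%:E * \int[mu]_z h z.
Proof.
move=> mh h0 L0 S.
pose D : set ('rV[R]_n * 'rV[R]_n) := [set yz | mcube yz.1 k yz.2].
have mD : measurable D.
  rewrite (_ : D = \big[setI/setT]_(i < n) ((fun yz : 'rV[R]_n * 'rV[R]_n => yz.2 ord0 i - yz.1 ord0 i)%R @^-1`
      `](- (2 * 2 ^- k))%R, (2 * 2 ^- k)%R[)).
    apply: bigsetI_measurable => i _; rewrite -[X in measurable X]setTI.
    apply: measurable_funB => //.
      exact: measurableT_comp (measurable_coord i) measurable_snd.
    exact: measurableT_comp (measurable_coord i) measurable_fst.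
  rewrite -bigcap_seq; apply/seteqP; split=> [z zD i _ /=|z zD i].
    by have := zD i; rewrite !mxE -ltr_distl ltr_norml in_itv.
  by have := zD i (mem_index_enum i); rewrite /= in_itv/= !mxE -ltr_distl ltr_norml.
pose F (yz : 'rV[R]_n * 'rV[R]_n) : \bar R := h yz.2 * (\1_D yz)%:E.
have mF : measurable_fun setT F.
  apply: emeasurable_funM; first exact: measurableT_comp.
  by apply/measurable_EFinP; exact: measurable_indic.
have F0 yz : 0 <= F yz by rewrite mule_ge0// lee_fin.
have FE y : \int[mu]_(z in mcube y k) h z = \int[mu]_z F (y, z).
  rewrite integral_mkcond; apply: eq_integral => z _.
  rewrite patchE /F indicE; case: ifPn => [/set_mem yz|].
    by rewrite mem_set// mule1.
  by rewrite notin_setE => yz; rewrite memNset// mule0.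
have mI : measurable_fun setT (fun y => \int[mu]_z F (y, z)).
  exact: (@measurable_fun_fubini_tonelli_F _ _ _ _ _ mu F).
have mS : measurable S.
  rewrite -[X in measurable X]setTI; apply: emeasurable_fun_c_infty => //.
  by rewrite (_ : (fun y => _) = (fun y => \int[mu]_z F (y, z)))//; apply/funext.
split=> //.
apply: (@le_trans _ _ (\int[mu]_y \int[mu]_z F (y, z))).
  rewrite -integral_cst// [leLHS]integral_mkcond; apply: ge0_le_integral => //.
  - by move=> y _; rewrite patchE; case: ifPn => // _; rewrite lee_fin.
  - by apply/(measurable_restrictT _ _).1 => //; exact: measurable_cst.
  - move=> y _; rewrite patchE; case: ifPn => [/set_mem|_].
      by rewrite /S/= FE.
    exact: integral_ge0.
rewrite (@fubini_tonelli _ _ _ _ _ mu mu F)//.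
rewrite -ge0_integralZl// le_eqVlt; apply/orP; left; apply/eqP.
apply: eq_integral => z _; rewrite /F/= -(lebesgue_mcube z k).
have DE x : (\1_D (x, z))%:E = (\1_(mcube z k) x)%:E :> \bar R.
  rewrite !indicE; congr ((_ : bool)%:R%:E); apply/idP/idP => /set_mem h1;
    apply/mem_set => i; have := h1 i; by rewrite !mxE -!ltr_distl distrC.
under eq_integral do rewrite DE.
rewrite ge0_integralZl//.
  by rewrite integral_indic ?setIT 1?muleC//; exact: measurable_mcube.
by apply/measurable_EFinP; apply: measurable_indic; exact: measurable_mcube.
Qed.

End power_estimates.

Lemma powR2N_lt1 {R : realType} (x : R) : 0 < x -> 2 `^ (- x) < 1 :> R.
Proof.
move=> x0; have h : (1 : R) < 2 by rewrite ltr1n.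
rewrite powRN invf_lt1 ?powR_gt0//.
by have := gt0_ltr_powR x0 _ _ h; rewrite powR1; apply; rewrite nnegrE.
Qed.

Lemma geometric_sum_le {R : realType} (x : R) m : 0 <= x -> x < 1 ->
  \sum_(0 <= k < m) x ^+ k <= (1 - x)^-1.
Proof.
move=> x0 x1; rewrite -div1r ler_pdivlMr ?subr_gt0// mulrC big_mkord.
by rewrite -[1 - x]opprB mulNr -subrX1 opprB lerBlDr lerDl exprn_ge0.
Qed.

(** * Dyadic thresholds *)

Section thresholds.
Context {R : realType}.
Variables (q beta K0 : R).
Hypotheses (q1 : 1 <= q) (beta0 : 0 < beta) (K00 : 0 < K0).

(** The bound gamma <= beta keeps the energies at coarse scales above 2^(-beta q K), and gamma <=
    1/2 keeps the measures at fine scales summable. The factor a below makes each side of K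
    contribute at most 1/8 to the sum of the thresholds. *)
Let gamma : R := Num.min beta 2^-1.
Let theta : R := 2 `^ (- gamma).
Let a : R := (1 - theta) / 8.

Definition threshold_const : R := (a / (2 * K0)) `^ q.

(* Thresholds for the dyadic increments around the critical scale K. With the
   truncated subtraction of nat the exponent is |k - K|. *)
Definition threshold (K k : nat) : R := a * theta ^+ ((k - K) + (K - k)).

(** The level produced by [mcube_power_bound] for an increment of size [threshold K k]. *)
Definition threshold_level (K k : nat) : R := threshold K k * 2 ^+ k / (2 * K0).

Let gamma0 : 0 < gamma.
Proof. by rewrite lt_min beta0 invr_gt0 ltr0n. Qed.

Let theta0 : 0 < theta. Proof. by rewrite powR_gt0. Qed.

Let theta1 : theta < 1. Proof. exact: powR2N_lt1. Qed.

Let a0 : 0 < a. Proof. by rewrite divr_gt0// subr_gt0. Qed.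

Lemma threshold_gt0 K k : 0 < threshold K k.
Proof. by rewrite mulr_gt0// exprn_gt0. Qed.

Lemma threshold_const_gt0 : 0 < threshold_const.
Proof. by rewrite powR_gt0// divr_gt0// mulr_gt0. Qed.

(** As a < 1/2, one constant serves for the increments and also for the threshold 1/2 on the average
    at scale 0. *)
Lemma threshold_const_le : threshold_const <= (1 / 2 / (2 * K0)) `^ q.
Proof.
have K20 : 0 < 2 * K0 by rewrite mulr_gt0.
apply: ge0_ler_powR.
- by rewrite (le_trans ler01).
- by rewrite nnegrE ltW// divr_gt0.
- by rewrite nnegrE ltW// divr_gt0// divr_gt0.
rewrite (ler_pM2r (x := (2 * K0)^-1)) ?invr_gt0//.
rewrite /a; have := theta0; lra.
Qed.

Lemma sum_threshold K m : \sum_(0 <= k < m) threshold K k <= 1 / 4.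
Proof.
have e0 k : 0 <= threshold K k by exact/ltW/threshold_gt0.
(* Extending the range to K + m allows a split at K whichever of K and m is larger. *)
apply: (@le_trans _ _ (\sum_(0 <= k < K + m) threshold K k)).
  rewrite [leRHS](big_cat_nat _ (n := m))//=; last exact: leq_addl.
  by rewrite lerDl sumr_ge0.
rewrite (big_cat_nat _ (n := K))//=; last exact: leq_addr.
have t1 : (1 - theta)^-1 * a = 1 / 8.
  by rewrite /a; field; rewrite gt_eqF ?subr_gt0.
have h1 : \sum_(0 <= k < K) threshold K k <= 1 / 8.
  rewrite -t1 big_nat_rev/= add0n mulrC.
  apply: (@le_trans _ _ (a * \sum_(0 <= k < K) theta ^+ k)).
    rewrite mulr_sumr; apply: ler_sum_nat => k /andP[_ kK]; rewrite /threshold.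
    rewrite ler_pM2l//.
    have -> : (K - k.+1 - K + (K - (K - k.+1)) = k.+1)%N by lia.
    by rewrite exprS ler_piMl ?exprn_ge0 ?ltW.
  by rewrite ler_pM2l// geometric_sum_le ?ltW.
have h2 : \sum_(K <= k < K + m) threshold K k <= 1 / 8.
  rewrite -t1 mulrC -[X in \sum_(X <= _ < _) _]add0n big_addn addKn.
  apply: (@le_trans _ _ (a * \sum_(0 <= k < m) theta ^+ k)).
    rewrite mulr_sumr; apply: ler_sum_nat => k _; rewrite /threshold.
    by have -> : (k + K - K + (K - (k + K)) = k)%N by lia.
  by rewrite ler_pM2l// geometric_sum_le ?ltW.
by rewrite (_ : 1 / 4 = 1 / 8 + 1 / 8) ?lerD//; field.
Qed.

Let pow2D (x y : R) : 2 `^ (x + y) = 2 `^ x * 2 `^ y :> R.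
Proof. by rewrite powRD// pnatr_eq0 implybT. Qed.

Let pow2n k : 2 ^+ k = 2 `^ k%:R :> R.
Proof. by rewrite powR_mulrn. Qed.

Let theta_exp k : theta ^+ k = 2 `^ (- gamma * k%:R).
Proof. by rewrite powRrM powR_mulrn// powR_ge0. Qed.

Lemma threshold_levelE K k : threshold_level K k `^ q = threshold_const *
  2 `^ (q * (k%:R - gamma * ((k - K) + (K - k))%:R)).
Proof.
rewrite /threshold_level /threshold theta_exp pow2n.
have -> : a * 2 `^ (- gamma * (k - K + (K - k))%:R) * 2 `^ k%:R / (2 * K0) =
   a / (2 * K0) * 2 `^ (k%:R - gamma * ((k - K) + (K - k))%:R).
  by rewrite [in RHS]addrC pow2D mulNr; ring.
have aK : 0 <= a / (2 * K0) by rewrite ltW// divr_gt0// mulr_gt0.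
rewrite (powRM q aK (powR_ge0 _ _)).
by congr (_ * _); rewrite -powRrM mulrC.
Qed.

(** The exponent of 2 is -(n - q) k - q gamma (K - k). Bounding n - q by beta q and gamma by beta
    turns it into -beta q K, independently of k. *)
Lemma threshold_level_low n K k : n%:R - q <= beta * q -> (k <= K)%N ->
  threshold_const * 2 `^ (- (beta * q * K%:R)) <= threshold_level K k `^ q * (4 * 2 ^- k) ^+ n.
Proof.
move=> nq kK; rewrite threshold_levelE -(mulrA threshold_const) (ler_pM2l threshold_const_gt0).
apply: (@le_trans _ _ (2 `^ (q * (k%:R - gamma * ((k - K) + (K - k))%:R)) * 2 `^ (- (k * n)%:R))).
  rewrite -pow2D; apply: ler_powR; first by rewrite ler1n.
  have -> : (k - K + (K - k) = K - k)%N by lia.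
  rewrite natrB// natrM.
  have gb : gamma <= beta by rewrite ge_min lexx.
  have kK0 : 0 <= K%:R - k%:R :> R by rewrite subr_ge0 ler_nat.
  have : gamma * (K%:R - k%:R) <= beta * (K%:R - k%:R) by exact: ler_wpM2r.
  have q0 : 0 <= q by rewrite (le_trans ler01).
  move=> /(ler_wpM2l q0); have := ler_wpM2l (ler0n R k) nq.
  lra.
rewrite ler_pM2l ?powR_gt0// powRN powR_mulrn// exprMn exprVn -exprM.
by rewrite ler_peMl ?invr_ge0 ?exprn_ge0// exprn_ege1// ler1n.
Qed.

(** As gamma <= 1/2, the exponent K + 1 + j - gamma (j + 1) is at least K + j/2; then q >= 1 leaves
    a geometric series of ratio 2^(-1/2). *)
Lemma threshold_level_high K j : (threshold_level K (K.+1 + j) `^ q)^-1 <=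
  threshold_const^-1 * 2 `^ (- (q * K%:R)) * (2 `^ (- 2^-1)) ^+ j.
Proof.
rewrite threshold_levelE invfM -(mulrA threshold_const^-1) ler_pM2l ?invr_gt0 ?threshold_const_gt0//.
rewrite -powRN -powR_mulrn ?powR_ge0// -powRrM -pow2D.
apply: ler_powR; first by rewrite ler1n.
have -> : (K.+1 + j - K + (K - (K.+1 + j)) = j.+1)%N by lia.
have g2 : gamma <= 2^-1 by rewrite ge_min lexx orbT.
rewrite natrD -[K.+1]addn1 -[j.+1]addn1 !natrD.
have j0 : 0 <= j%:R :> R by rewrite ler0n.
have h : j%:R / 2 + K%:R <= K%:R + 1 + j%:R - gamma * (j%:R + 1).
  have : gamma * (j%:R + 1) <= 2^-1 * (j%:R + 1) by rewrite ler_wpM2r// addr_ge0.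
  lra.
have q0 : 0 <= q by rewrite (le_trans ler01).
have := ler_wpM2l q0 h; have : j%:R / 2 <= q * (j%:R / 2) by rewrite ler_peMl ?divr_ge0.
lra.
Qed.

End thresholds.

Section weak_type_sobolev.
Context {R : realType} {n : nat}.
Local Notation mu := (@lebesgue_rV R n).

Lemma increments_dichotomy (w e : nat -> R) m : w m = 1 ->
  \sum_(0 <= k < m) e k <= 1 / 4 ->
  1 / 2 <= `|w 0%N| \/ exists2 k, (k < m)%N & e k <= `|w k.+1 - w k|.
Proof.
move=> wm se; have [|w0] := leP (1 / 2) `|w 0%N|; [by left|right].
apply: contrapT => h.
have {}h k : (k < m)%N -> `|w k.+1 - w k| <= e k.
  by move=> km; rewrite leNgt; apply/negP => ek; apply: h; exists k => //; exact: ltW.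
have : `|w m - w 0%N| <= \sum_(0 <= k < m) e k.
  rewrite -telescope_sumr//; apply: le_trans (ler_norm_sum _ _ _) _.
  by apply: ler_sum_nat => k /andP[_]; exact: h.
rewrite wm => h1; have := ler_normD (1 - w 0%N) (w 0%N).
by rewrite subrK normr1; lra.
Qed.

Lemma eseries_geometric_le (c x : R) (u : nat -> \bar R) : 0 <= c -> 0 <= x -> x < 1 ->
  (forall j, 0 <= u j)%E -> (forall j, u j <= (c * x ^+ j)%:E)%E ->
  (\sum_(0 <= j <oo) u j <= (c / (1 - x))%:E)%E.
Proof.
move=> c0 x0 x1 u0 ux; apply: lime_le; first by apply: is_cvg_nneseries => j _ _.
apply: nearW => m; apply: (@le_trans _ _ (\sum_(0 <= j < m) (c * x ^+ j)%:E)%E).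
  by apply: lee_sum => j _.
by rewrite sumEFin lee_fin -mulr_sumr ler_wpM2l// geometric_sum_le.
Qed.

(** The bound used for energies N that vanish or are not small. *)
Lemma measure_le_Lp_norm (q N : R) (v : 'rV[R]_n -> R) (A : set 'rV[R]_n) :
  measurable_fun setT v -> measurable A ->
  {ae mu, forall z, A z -> v z = 1} ->
  (\int[mu]_z (`|v z| `^ q)%:E <= N%:E)%E -> (mu A <= N%:E)%E.
Proof.
move=> mv mA v1; apply: le_trans.
have mpow D : measurable D -> measurable_fun D (fun z => (`|v z| `^ q)%:E).
  move=> mD; apply/measurable_EFinP; apply: (measurableT_comp (measurable_powR q)).
  by apply: measurableT_comp => //; exact: measurable_funTS.
apply: (@le_trans _ _ (\int[mu]_(z in A) (`|v z| `^ q)%:E)%E); last first.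
  by apply: ge0_subset_integral => //; exact: mpow.
rewrite -[leLHS]mul1e -integral_cst// le_eqVlt; apply/orP; left; apply/eqP.
apply: ge0_ae_eq_integral => //.
- exact: mpow.
- by apply: filterS v1 => z h /h ->; rewrite normr1 powR1.
Qed.

Lemma open_mavg1 (v : 'rV[R]_n -> R) (A : set 'rV[R]_n) y :
  locally_integrable_rV setT v -> open A ->
  {ae mu, forall z, A z -> v z = 1} -> A y -> exists m, mavg v y m = 1.
Proof.
move=> lv oA v1 Ay.
have /nbhs_ballP[d /= d0 yd] := open_nbhs_nbhs (conj oA Ay).
have [m md] : exists m : nat, 2 ^- m < d.
  have : (1 / 2) ^+ m @[m --> \oo] --> (0 : R).
    by apply: cvg_expr; rewrite ger0_norm; lra.
  move/cvgrPdist_lt/(_ _ d0) => [m _ /(_ m (leqnn _))]; rewrite sub0r normrN.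
  rewrite ger0_norm ?exprn_ge0// expr_div_n expr1n div1r => h.
  by exists m.
exists m; apply: (mavg_cst lv (open_measurable_rV oA)) => // z zy.
apply: yd; apply/(rV_ballP _ _ d0) => i; apply: le_lt_trans md.
by have := zy i; rewrite !mxE distrC ler_distl.
Qed.

Lemma critical_scale (x b : R) : 0 < x -> x <= 1 -> 0 < b ->
  exists K : nat, x <= 2 `^ (- (b * K%:R)) /\ 2 `^ (- (b * K.+1%:R)) <= x.
Proof.
(* L solves 2^(-b L) = x, and K is its integer part; x <= 1 makes L nonnegative. *)
move=> x0 x1 b0; pose L := - ln x / (b * ln 2).
have l2 : 0 < ln (2 : R) by rewrite ln_gt0// ltr1n.
have bl : 0 < b * ln 2 by rewrite mulr_gt0.
have L0 : 0 <= L by rewrite divr_ge0 ?(ltW bl)// oppr_ge0 ln_le0.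
have Lx : 2 `^ (- (b * L)) = x.
  rewrite /powR pnatr_eq0/= -[RHS]lnK// /L; congr expR.
  by field; rewrite !gt_eqF.
exists (Num.truncn L); have /andP[h1 h2] := truncn_itv L0.
split; rewrite -{1}Lx; apply: ler_powR; rewrite ?ler1n// lerN2 ler_pM2l// ltW//.
Qed.

End weak_type_sobolev.

Section weak_type_sobolev_inequality.
Context {R : realType} {n : nat}.
Local Notation mu := (@lebesgue_rV R n).
Variables (q beta B : R).
Hypotheses (n0 : (0 < n)%N) (q1 : 1 <= q) (beta0 : 0 < beta)
  (nq : n%:R - q <= beta * q)
  (hB : forall s : R, `|step_bump s| <= B) (B1 : 1 <= B).

Let K0 : R := n%:R * (8 * B) ^+ n.
Let c1 : R := threshold_const q beta K0.
Let lam K k : R := threshold_level beta K0 K k.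

Let B0 : 0 < B. Proof. exact: lt_le_trans ltr01 B1. Qed.
Let K00 : 0 < K0.
Proof. by rewrite mulr_gt0 ?ltr0n// exprn_gt0// mulr_gt0. Qed.
Let c10 : 0 < c1. Proof. exact: threshold_const_gt0. Qed.
Let q0 : 0 < q. Proof. exact: lt_le_trans ltr01 q1. Qed.

Variables (v : 'rV[R]_n -> R) (g : 'rV[R]_n -> 'rV[R]_n) (A : set 'rV[R]_n) (N : R).
Hypotheses (lv : locally_integrable_rV setT v) (vg : is_weak_gradient setT v g)
  (oA : open A) (v1 : {ae mu, forall z, A z -> v z = 1})
  (vN : (\int[mu]_z (`|v z| `^ q)%:E <= N%:E)%E)
  (gN : (\int[mu]_z (`|euclidean_norm (g z)| `^ q)%:E <= N%:E)%E).

Let mg : measurable_fun setT (euclidean_norm \o g).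
Proof. by apply: measurable_euclidean_norm => // i; case: (vg i) => -[]. Qed.

Let mv : measurable_fun setT v. Proof. by case: lv. Qed.

Let le_cube (h : 'rV[R]_n -> R) y k : measurable_fun setT h ->
  (\int[mu]_z (`|h z| `^ q)%:E <= N%:E ->
   \int[mu]_(z in mcube y k) (`|h z| `^ q)%:E <= N%:E)%E.
Proof.
move=> mh; apply: le_trans; apply: ge0_subset_integral => //.
- exact: measurable_mcube.
- apply/measurable_EFinP; apply: (measurableT_comp (measurable_powR q)).
  exact: measurableT_comp.
Qed.

(** Scale 0 is handled like an increment, with v in place of its gradient: the constant of
    [mavg0_bound] is multiplied by n >= 1 to reach the shape that [mcube_power_bound] expects. *)
Let low_scales y : 1 / 2 <= `|mavg v y 0| -> c1 <= N.
Proof.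
move=> h; have n1 : 1 <= n%:R :> R by rewrite ler1n.
have he : ((1 / 2)%:E <= (n%:R * ((2 ^+ 1 * B) ^+ n * 2 ^- 0))%:E *
    \int[mu]_(z in mcube y 0) (`|v z|)%:E)%E.
  rewrite -lee_fin in h; apply: le_trans h _; apply: le_trans (mavg0_bound lv hB B1 y) _.
  apply: lee_wpmul2r; first exact: integral_ge0.
  by rewrite lee_fin expr1 expr0 invr1 mulr1 ler_peMl// exprn_ge0// mulr_ge0// ltW.
have := mcube_power_bound n0 q1 _ B1 mv he; rewrite expr0 mulr1 -/K0 lebesgue_mcube.
move=> /(_ _)/le_trans h2; have {}h2 := h2 _ _ (le_cube y 0 mv vN).
have := h2 ltac:(lra); rewrite -EFinM lee_fin => h3.
apply: le_trans (threshold_const_le q1 beta0 K00) _; apply: le_trans h3.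
rewrite ler_peMr ?powR_ge0// expr0 invr1 mulr1 exprn_ege1//; lra.
Qed.

Let high_scales y K k : threshold beta K k <= `|mavg v y k.+1 - mavg v y k| ->
  ((lam K k `^ q * (4 * 2 ^- k) ^+ n)%:E <=
    \int[mu]_(z in mcube y k) (`|euclidean_norm (g z)| `^ q)%:E)%E.
Proof.
move=> h; rewrite -lee_fin in h.
have := mcube_power_bound n0 q1 (threshold_gt0 beta0 K k) B1 mg
  (le_trans h (mavg_step_bound lv vg hB B1 y k mg)).
by rewrite -/K0 lebesgue_mcube -EFinM.
Qed.

(** The first bound on N excludes a large average at scale 0, the second a large increment at any
    scale k <= K. The sets S k with k > K then cover A. *)
Lemma measure_critical_scale K : N < c1 -> N < c1 * 2 `^ (- (beta * q * K%:R)) ->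
  (mu A <= (N * c1^-1 * 2 `^ (- (q * K%:R)) / (1 - 2 `^ (- 2^-1)))%:E)%E.
Proof.
move=> Nc1 NK.
have N0 : 0 <= N.
  by rewrite -lee_fin; apply: le_trans vN; apply: integral_ge0 => z _; rewrite lee_fin powR_ge0.
pose h z := (`|euclidean_norm (g z)| `^ q)%:E.
have mh : measurable_fun setT h.
  apply/measurable_EFinP; apply: (measurableT_comp (measurable_powR q)).
  exact: measurableT_comp.
have h0 z : (0 <= h z)%E by rewrite lee_fin powR_ge0.
pose L K k : R := lam K k `^ q * (4 * 2 ^- k) ^+ n.
have d0 k : 0 < 4 * 2 ^- k :> R by rewrite mulr_gt0// invr_gt0 exprn_gt0.
have lam0 K' k : 0 < lam K' k `^ q.
  apply/powR_gt0/divr_gt0; last by rewrite mulr_gt0.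
  by apply: mulr_gt0; [exact: threshold_gt0|rewrite exprn_gt0].
have L0 K' k : 0 < L K' k by rewrite mulr_gt0// exprn_gt0.
pose S k := [set y | ((L K k)%:E <= \int[mu]_(z in mcube y k) h z)%E].
have SP k : measurable (S k) /\ (mu (S k) <= (N / lam K k `^ q)%:E)%E.
  have [mS SN] := mcube_fubini k mh h0 (ltW (L0 K k)).
  split; first exact: mS.
  have dE : (0 <= ((4 * 2 ^- k) ^+ n)%:E :> \bar R)%E by rewrite lee_fin exprn_ge0// ltW.
  have {}SN := le_trans SN (lee_wpmul2l dE gN).
  suff : ((L K k)%:E * mu (S k) <= (L K k)%:E * (N / lam K k `^ q)%:E)%E.
    by rewrite lee_pmul2l// lte_fin.
  apply: le_trans SN _; rewrite -!EFinM lee_fin /L.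
  rewrite le_eqVlt; apply/orP; left; apply/eqP; field.
  by rewrite gt_eqF.
have cover : A `<=` \bigcup_j S (K.+1 + j)%N.
  move=> y Ay; have [m ym] := open_mavg1 lv oA v1 Ay.
  have [/low_scales|[k km /high_scales kS]] :=
    increments_dichotomy ym (sum_threshold q1 beta0 K00 K m).
    by rewrite leNgt Nc1.
  have [kK|Kk] := leqP k K.
    have := le_trans kS (le_cube y k mg gN); rewrite lee_fin => kN.
    have := le_trans (threshold_level_low q1 beta0 K00 nq kK) kN.
    by rewrite leNgt NK.
  by exists (k - K.+1)%N => //; rewrite /S/= subnKC.
have mA := open_measurable_rV oA.
apply: (@le_trans _ _ (\sum_(0 <= j <oo) mu (S (K.+1 + j)%N))%E).
  by apply: measure_sigma_subadditive => // j; exact: (SP _).1.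
apply: eseries_geometric_le => //.
- by rewrite !mulr_ge0 ?invr_ge0 ?powR_ge0// ltW.
- by rewrite powR2N_lt1// invr_gt0.
- move=> j; apply: le_trans (SP _).2 _; rewrite lee_fin -!mulrA ler_wpM2l//.
  by rewrite mulrA; exact: threshold_level_high.
Qed.

End weak_type_sobolev_inequality.

(** For q < n the condition linking n, q and sigma says sigma <= n/(n - q), that is sigma q <= q* ;
    for q >= n it holds for every sigma > 1. *)
Lemma weak_type_sobolev {R : realType} n (q sigma : R) :
  (0 < n)%N -> 1 <= q -> 1 < sigma -> n%:R - q <= (sigma - 1)^-1 * q ->
  exists2 C : R, 0 < C & forall (v : 'rV[R]_n -> R) A (N : R),
    sobolev setT q v -> open A ->
    {ae (lebesgue_rV n), forall z, A z -> v z = 1} -> 0 <= N ->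
    (\int[lebesgue_rV n]_z
       (`|v z| `^ q + euclidean_norm (weak_gradient setT v z) `^ q)%:E <= N%:E)%E ->
    (lebesgue_rV n A <= (C * N `^ sigma)%:E)%E.
Proof.
move=> n0 q1 s1 nq.
have [B B0 hB'] := @step_bump_bounded R.
have hB (s : R) : `|step_bump s| <= B + 1 by rewrite (le_trans (hB' s))// lerDl.
have B1 : 1 <= B + 1 by rewrite lerDr ltW.
have sp : 0 < sigma - 1 by rewrite subr_gt0.
have beta0 : 0 < (sigma - 1)^-1 by rewrite invr_gt0.
have q0 : 0 < q by rewrite (lt_le_trans ltr01).
have K00 : 0 < n%:R * (8 * (B + 1)) ^+ n.
  by rewrite mulr_gt0 ?ltr0n// exprn_gt0// mulr_gt0// (lt_le_trans ltr01).
have := @threshold_const_gt0 R q (sigma - 1)^-1 _ beta0 K00.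
set c1 := threshold_const _ _ _ => c10.
have r1 : 0 < 1 - 2 `^ (- 2^-1) :> R.
  by rewrite subr_gt0 powR2N_lt1// invr_gt0.
pose D : R := (2 / c1) `^ (sigma - 1).
have D0 : 0 < D by apply/powR_gt0/divr_gt0.
(* The first summand serves the critical scale argument, the second the case 2 N > c1, where |A| <=
   N is enough. *)
pose C : R := c1^-1 * 2 `^ q * D / (1 - 2 `^ (- 2^-1)) + D.
have E0 : 0 < c1^-1 * 2 `^ q * D / (1 - 2 `^ (- 2^-1)).
  by rewrite divr_gt0// mulr_gt0// mulr_gt0 ?invr_gt0// powR_gt0.
exists C => [|v A N [[mv _] [lv [g vg]] _] oA v1 N0 vN]; first by rewrite addr_gt0.
have {g vg}vg := weak_gradientP vg; set g := weak_gradient setT v in vg vN.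
have mg : measurable_fun setT (euclidean_norm \o g).
  by apply: measurable_euclidean_norm => // i; case: (vg i) => -[].
have mpow (h : 'rV[R]_n -> R) : measurable_fun setT h ->
    measurable_fun setT (fun z => (`|h z| `^ q)%:E).
  move=> mh; apply/measurable_EFinP; apply: (measurableT_comp (measurable_powR q)).
  exact: measurableT_comp.
have mvg : measurable_fun setT (fun z => (`|v z| `^ q + euclidean_norm (g z) `^ q)%:E).
  apply/measurable_EFinP; apply: measurable_funD.
    by apply: (measurableT_comp (measurable_powR q)); exact: measurableT_comp.
  exact: (measurableT_comp (measurable_powR q) mg).
have iv : (\int[lebesgue_rV n]_z (`|v z| `^ q)%:E <= N%:E)%E.
  apply: le_trans vN; apply: ge0_le_integral => //; first exact: mpow.
  by move=> z _; rewrite lee_fin lerDl powR_ge0.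
have ig : (\int[lebesgue_rV n]_z (`|euclidean_norm (g z)| `^ q)%:E <= N%:E)%E.
  apply: le_trans vN; apply: ge0_le_integral => //; first exact: (mpow (euclidean_norm \o g)).
  by move=> z _; rewrite lee_fin ger0_norm ?euclidean_norm_ge0// lerDr powR_ge0.
have AN := measure_le_Lp_norm mv (open_measurable_rV oA) v1 iv.
have C0 : 0 <= C by rewrite addr_ge0 ?ltW.
(* For N = 0 there is no finite critical scale, but |A| <= N settles the claim. *)
have [N00|NN0] := eqVneq N 0.
  apply: le_trans AN _; rewrite lee_fin N00 mulr_ge0// powR_ge0//.
have {N0 NN0}N0 : 0 < N by rewrite lt_neqAle eq_sym NN0.
have NS : N `^ sigma = N * N `^ (sigma - 1).
  by rewrite mulr_powRB1// ?ltW// (lt_trans ltr01).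
have xD : (2 * N / c1) `^ (sigma - 1) = D * N `^ (sigma - 1).
  by rewrite mulrAC powRM ?(ltW N0)// ltW// divr_gt0.
have [Nc|cN] := leP (2 * N) c1; last first.
  apply: le_trans AN _; rewrite lee_fin; apply: (@le_trans _ _ (D * N `^ sigma)).
    rewrite NS mulrCA -xD ler_peMr ?(ltW N0)//.
    rewrite -[leLHS](powRr0 (2 * N / c1)); apply: ler_powR; last exact: ltW.
    by rewrite ler_pdivlMr// mul1r ltW.
  by rewrite ler_wpM2r ?powR_ge0// lerDr ltW.
(* The factor 2 turns x <= 2^(-beta q K) into the strict inequality [NK]. *)
pose x := 2 * N / c1.
have x0 : 0 < x by rewrite divr_gt0// mulr_gt0.
have x1 : x <= 1 by rewrite ler_pdivrMr// mul1r.
have b0 : 0 < (sigma - 1)^-1 * q by rewrite mulr_gt0.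
have [K [xK Kx]] := critical_scale x0 x1 b0.
have Nc1 : N < c1 by apply: lt_le_trans Nc; lra.
have NK : N < c1 * 2 `^ (- ((sigma - 1)^-1 * q * K%:R)).
  apply: (@lt_le_trans _ _ (c1 * x)); last by rewrite ler_pM2l.
  by rewrite /x mulrC divfK ?gt_eqF//; lra.
apply: le_trans (measure_critical_scale n0 q1 beta0 nq hB B1 lv vg oA v1 iv ig Nc1 NK) _.
rewrite -/c1 lee_fin; apply: (@le_trans _ _
  (c1^-1 * 2 `^ q * D / (1 - 2 `^ (- 2^-1)) * N `^ sigma)); last first.
  by rewrite ler_wpM2r ?powR_ge0// lerDl ltW.
rewrite [leRHS]mulrAC ler_pM2r ?invr_gt0// NS.
have -> : c1^-1 * 2 `^ q * D * (N * N `^ (sigma - 1)) =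
  N / c1 * (2 `^ q * (D * N `^ (sigma - 1))) by ring.
rewrite ler_pM2l ?divr_gt0// -xD.
(* The upper estimate in [Kx] is at K + 1, and passing to it costs the factor 2^q in C. *)
have -> : 2 `^ (- (q * K%:R)) = 2 `^ q * 2 `^ (- (q * K.+1%:R)) :> R.
  rewrite -powRD ?pnatr_eq0 ?implybT//; congr (2 `^ _).
  by rewrite -[K.+1]addn1 natrD; ring.
rewrite ler_pM2l ?powR_gt0//.
have -> : 2 `^ (- (q * K.+1%:R)) =
    (2 `^ (- ((sigma - 1)^-1 * q * K.+1%:R))) `^ (sigma - 1) :> R.
  by rewrite -powRrM; congr (2 `^ _); field; rewrite gt_eqF.
by apply: ge0_ler_powR; rewrite ?nnegrE ?powR_ge0// ltW.
Qed.

(** * The measure density estimate *)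

Section density.
Context {R : realType}.

(* De Giorgi iteration along the radii r (1 + 2^-j) / 2. *)
Lemma lower_bound_of_decay (M kappa t : R) : 0 < M -> 1 < kappa -> 0 < t ->
  exists2 delta : R, 0 < delta & forall (phi : R -> R) (d : R),
    (forall r, 0 < r -> 0 < phi r) -> (forall a b, 0 < a -> a <= b -> phi a <= phi b) ->
    (forall rho r, 0 < rho -> rho < r -> r <= d ->
       phi rho <= M * phi r `^ kappa / (r - rho) `^ t) ->
    forall r, 0 < r -> r <= d -> delta * r `^ (t / (kappa - 1)) <= phi r.
Proof.
move=> M0 k1 t0; have a0 : 0 < kappa - 1 by rewrite subr_gt0.
(* Chosen so that l^(kappa - 1) = 2^(-t): the gain of phi(rr j)^(kappa - 1) then cancels the loss
   (2^-j)^(-t) from the shrinking gaps. *)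
pose l : R := 2 `^ (- (t / (kappa - 1))).
have l0 : 0 < l by rewrite powR_gt0.
have l1 : l < 1 by rewrite powR2N_lt1// divr_gt0.
have la : l `^ (kappa - 1) = 2 `^ (- t).
  by rewrite -powRrM; congr (2 `^ _); field; rewrite gt_eqF.
have c0 : 0 < l / (M * 4 `^ t) by rewrite divr_gt0// mulr_gt0// powR_gt0.
(* With this delta, a value of phi r below the claimed bound makes the first step gain the factor l;
   the 4 comes from rr j - rr (j+1) = (r/4) 2^-j. *)
exists ((l / (M * 4 `^ t)) `^ (kappa - 1)^-1) => [|phi d phi0 mono decay r r0 rd].
  exact: powR_gt0.
rewrite leNgt; apply/negP => small.
have f0 : 0 < phi r by exact: phi0.
have small' : M * 4 `^ t * phi r `^ (kappa - 1) / r `^ t <= l.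
  rewrite ler_pdivrMr ?powR_gt0// mulrC -ler_pdivlMr ?mulr_gt0 ?powR_gt0//.
  have -> : l * r `^ t / (M * 4 `^ t) =
     ((l / (M * 4 `^ t)) `^ (kappa - 1)^-1 * r `^ (t / (kappa - 1))) `^ (kappa - 1).
    rewrite powRM ?powR_ge0// -!powRrM mulVf ?gt_eqF// powRr1 ?(ltW c0)//.
    by rewrite divfK ?gt_eqF// mulrAC.
  apply: ge0_ler_powR; rewrite ?nnegrE ?mulr_ge0 ?powR_ge0// ltW//.
pose rr (j : nat) : R := r / 2 * (1 + 2 ^- j).
have p2 j : 0 < 2 ^- j :> R by rewrite invr_gt0 exprn_gt0.
have rr0 j : 0 < rr j by rewrite mulr_gt0 ?divr_gt0// addr_gt0.
have rrS j : rr j - rr j.+1 = r / 4 * 2 ^- j.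
  by rewrite /rr exprS invfM; field; rewrite gt_eqF// exprn_gt0.
have rrd j : rr j <= d.
  apply: le_trans rd; rewrite /rr; have h : 2 ^- j <= 1 :> R.
    by rewrite invf_le1 ?exprn_gt0// exprn_ege1// ler1n.
  have := ler_wpM2l (ltW r0) h; lra.
have iter j : phi (rr j) <= phi r * l ^+ j.
  elim: j => [|j IH].
    by rewrite expr0 mulr1 /rr expr0 invr1 (_ : r / 2 * (1 + 1) = r)//; field.
  have lt_rr : rr j.+1 < rr j by rewrite -subr_gt0 rrS mulr_gt0// divr_gt0.
  apply: le_trans (decay _ _ (rr0 _) lt_rr (rrd _)) _; rewrite rrS.
  have h1 : phi (rr j) `^ kappa <= (phi r * l ^+ j) `^ kappa.
    apply: ge0_ler_powR => //; rewrite ?nnegrE ?mulr_ge0 ?exprn_ge0 ?ltW// ?phi0//.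
    by rewrite (lt_trans ltr01).
  have den : 0 < (r / 4 * 2 ^- j) `^ t by rewrite powR_gt0 ?mulr_gt0 ?divr_gt0.
  apply: (@le_trans _ _ (M * (phi r * l ^+ j) `^ kappa / (r / 4 * 2 ^- j) `^ t)).
    by rewrite ler_pM2r ?invr_gt0// ler_pM2l.
  suff -> : M * (phi r * l ^+ j) `^ kappa / (r / 4 * 2 ^- j) `^ t =
      phi r * l ^+ j * (M * 4 `^ t * phi r `^ (kappa - 1) / r `^ t).
    by rewrite exprSr [leRHS]mulrA ler_pM2l// mulr_gt0// exprn_gt0.
  have lj0 : 0 < l ^+ j by rewrite exprn_gt0.
  have lja : (l ^+ j) `^ (kappa - 1) = (2 `^ (- t)) ^+ j.
    by rewrite -(powR_mulrn j (ltW l0)) powRAC la powR_mulrn ?powR_ge0.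
  have z0 : 0 < (2 `^ (- t)) ^+ j :> R by rewrite exprn_gt0 ?powR_gt0.
  have -> : (phi r * l ^+ j) `^ kappa =
      phi r * l ^+ j * (phi r `^ (kappa - 1) * (2 `^ (- t)) ^+ j).
    rewrite -(mulr_powRB1 (x := phi r * l ^+ j)) ?mulr_ge0 ?(ltW f0) ?(ltW lj0)//.
      by rewrite powRM ?(ltW f0) ?(ltW lj0)// lja.
    by rewrite (lt_trans ltr01).
  have -> : (r / 4 * 2 ^- j) `^ t = r `^ t / 4 `^ t * (2 `^ (- t)) ^+ j.
    have r4 : 0 <= r / 4 by rewrite divr_ge0 ?(ltW r0).
    have -> : (r / 4 * 2 ^- j) `^ t = (r * 4^-1) `^ t * (2 ^- j) `^ t.
      exact: powRM r4 (ltW (p2 j)).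
    have -> : (2 ^- j) `^ t = (2 `^ (- t)) ^+ j :> R.
      rewrite -(powR_invn j (ler0n R 2)) -powRrM.
      rewrite (_ : - j%:R * t = - t * j%:R); last by ring.
      by rewrite powRrM powR_mulrn ?powR_ge0.
    congr (_ * _); rewrite powRM ?(ltW r0) ?invr_ge0//; congr (_ * _).
    by rewrite -powRN -(powR_inv1 (ler0n R 4)) -powRrM mulN1r.
  have rt0 : 0 < r `^ t by rewrite powR_gt0.
  have t40 : 0 < 4 `^ t :> R by rewrite powR_gt0.
  move: rt0 t40 z0; set z := _ ^+ j; set rt := r `^ t; set ft := 4 `^ t => rt0 t40 z0.
  by field; rewrite !gt_eqF.
have half : 0 < phi (r / 2) by rewrite phi0 ?divr_gt0.
have [j hj] : exists j, l ^+ j < phi (r / 2) / phi r.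
  have : l ^+ j @[j --> \oo] --> (0 : R) by apply: cvg_expr; rewrite ger0_norm ?ltW.
  have e0 : 0 < phi (r / 2) / phi r by rewrite divr_gt0.
  move/cvgrPdist_lt/(_ _ e0) => [m _ /(_ m (leqnn _))]; rewrite sub0r normrN.
  by rewrite ger0_norm ?exprn_ge0 ?ltW// => h; exists m.
have rj : r / 2 <= rr j by rewrite /rr ler_peMr ?divr_ge0 ?ltW// ltrDl.
have := le_trans (mono _ _ (divr_gt0 r0 (ltr0n R 2)) rj) (iter j); rewrite leNgt => /negP; apply.
by rewrite mulrC -ltr_pdivlMr.
Qed.

End density.

(** * From the extension property to the density estimate *)

Section extension_density.
Context {R : realType} {n : nat}.
Local Notation mu := (@lebesgue_rV R n).

Lemma open_measure_gt0 (A : set 'rV[R]_n) y : open A -> A y -> (0 < mu A)%E.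
Proof.
move=> oA Ay; have /nbhs_ballP[d /= d0 yd] := open_nbhs_nbhs (conj oA Ay).
apply: (@lt_le_trans _ _ (mu (ball y d))); last first.
  apply: le_measure; rewrite ?inE//.
    by apply: open_measurable_rV; exact: ball_open.
  exact: open_measurable_rV.
rewrite rV_ballE// lebesgue_box => [|i]; last by rewrite !mxE; lra.
by rewrite lte_fin prodr_gt0// => i _; rewrite !mxE; lra.
Qed.

Lemma extension_decay (p q t d : R) (Omega : set 'rV[R]_n) :
  (0 < n)%N -> 1 <= q -> q < p -> p < t -> n%:R - q <= (t / q - 1)^-1 * q ->
  sobolev_extension_domain p q Omega ->
  exists2 M : R, 0 < M & forall x rho r, 0 < rho -> rho < r -> r <= d ->
    fine (mu (euclidean_ball x rho `&` Omega)) <=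
    M * fine (mu (euclidean_ball x r `&` Omega)) `^ (t / p) / (r - rho) `^ t.
Proof.
move=> n0 q1 qp pt nq [[_ oO _] _ [E [C1 C10 [_ EP]]]].
have q0 : 0 < q by rewrite (lt_le_trans ltr01).
have p0 : 0 < p by exact: lt_trans qp.
have t0 : 0 < t by exact: lt_trans pt.
have p1 : 1 <= p by rewrite (le_trans q1)// ltW.
have s1 : 1 < t / q by rewrite ltr_pdivlMr// mul1r (lt_trans qp).
have [C C0 weak] := @weak_type_sobolev R n q (t / q) n0 q1 s1 nq.
have [B B0 hB] := @step_bump_bounded R.
have mO := open_measurable_rV oO.
(* Since r - rho <= |d|, the term 1 coming from the function itself is at most |d|^p / (r - rho)^p,
   of the same form as the gradient term. *)
pose c : R := `|d| `^ p + (6 * B) `^ p.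
have c0 : 0 < c by rewrite ltr_wpDl ?powR_ge0//; apply/powR_gt0/mulr_gt0.
exists (C * C1 `^ t * c `^ (t / p)) => [|x rho r rho0 rhor rd].
  by rewrite !mulr_gt0// powR_gt0.
have r0 : 0 < r by exact: lt_trans rhor.
have rr0 : 0 < r - rho by rewrite subr_gt0.
pose phi s := fine (mu (euclidean_ball x s `&` Omega)).
have phiE s : 0 < s -> mu (euclidean_ball x s `&` Omega) = (phi s)%:E.
  by move=> s0; rewrite fineK// ge0_fin_numE// euclidean_ball_lty.
have phi0 s : 0 <= phi s by exact: fine_ge0.
pose Y : R := (1 + (6 * B / (r - rho)) `^ p) * phi r.
have Y0 : 0 <= Y by rewrite mulr_ge0// addr_ge0// powR_ge0.
pose u := cutoff x rho r.
have [sv Eu nv] := EP u (sobolev_cutoff x oO p1 hB rho0 rhor).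
have {}nv : (sobolev_norm setT q (E u) <= (C1 * Y `^ p^-1)%:E)%E.
  apply: le_trans nv _; rewrite EFinM; apply: lee_wpmul2l; first by rewrite lee_fin ltW.
  by apply: le_trans (sobolev_norm_cutoff x oO p1 hB rho0 rhor) _; rewrite phiE// -EFinM poweR_EFin.
pose N : R := (C1 * Y `^ p^-1) `^ q.
have N0 : 0 <= N by exact: powR_ge0.
have energy : (\int[mu]_z (`|E u z| `^ q +
    euclidean_norm (weak_gradient setT (E u) z) `^ q)%:E <= N%:E)%E.
  set T := (X in (X <= _)%E); have {}nv : (T `^ q^-1 <= (C1 * Y `^ p^-1)%:E)%E := nv.
  have T0 : (0 <= T)%E by apply: integral_ge0 => z _; rewrite lee_fin addr_ge0 ?powR_ge0.
  have -> : T = ((T `^ q^-1) `^ q)%E.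
    by rewrite -poweRrM mulVf ?gt_eqF// poweRe1.
  rewrite /N -poweR_EFin; apply: gt0_ler_poweR nv; first exact: ltW.
    by rewrite in_itv/= leey andbT poweR_ge0.
  by rewrite in_itv/= leey andbT lee_fin mulr_ge0 ?powR_ge0 ?(ltW C10).
have v1 : {ae mu, forall z, (euclidean_ball x rho `&` Omega) z -> E u z = 1}.
  apply: filterS Eu => z h [zx Oz]; rewrite h//; exact: cutoff_in.
have oA : open (euclidean_ball x rho `&` Omega).
  by apply: openI => //; exact: open_euclidean_ball.
have := weak _ _ _ sv oA v1 N0 energy.
rewrite phiE// lee_fin => /le_trans; apply.
have NE : N `^ (t / q) = C1 `^ t * Y `^ (t / p).
  rewrite /N -powRrM mulrCA divff ?gt_eqF// mulr1 powRM ?powR_ge0 ?(ltW C10)//.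
  by rewrite -powRrM (mulrC _ t).
have YE : Y `^ (t / p) <= c `^ (t / p) * phi r `^ (t / p) / (r - rho) `^ t.
  have -> : c `^ (t / p) * phi r `^ (t / p) / (r - rho) `^ t =
      (c * phi r / (r - rho) `^ p) `^ (t / p).
    rewrite powRM ?mulr_ge0 ?invr_ge0 ?powR_ge0 ?(ltW c0)//.
    rewrite (powRM _ (ltW c0) (phi0 r)); congr (_ * _).
    rewrite -!powRN -powRrM; congr (_ `^ _).
    by field; rewrite gt_eqF.
  apply: ge0_ler_powR; rewrite ?nnegrE ?Y0 ?mulr_ge0 ?invr_ge0 ?powR_ge0 ?(ltW c0) ?(ltW p0) ?(ltW t0)//.
  rewrite /Y [leRHS]mulrAC ler_wpM2r// ler_pdivlMr ?powR_gt0// mulrDl mul1r /c.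
  apply: lerD.
    apply: ge0_ler_powR; rewrite ?nnegrE ?(ltW p0) ?(ltW rr0)//.
    apply: le_trans (ler_norm d); lra.
  rewrite -powRM ?(ltW rr0)//; last by rewrite divr_ge0 ?(ltW rr0)// mulr_ge0// ltW.
  by rewrite divfK// gt_eqF.
rewrite NE -!mulrA; rewrite ler_pM2l// ler_pM2l ?powR_gt0//.
by rewrite !mulrA.
Qed.

End extension_density.

Theorem lemma3p1 (R : realType) (n : nat) (p q : R) (n2 : (2 <= n)%N)
    (q1 : 1 <= q) (qp : q < p) (pqs : (p%:E < sobolev_conjugate n q)%E) :
  exists s : R,
    [/\ n%:R <= s,
        q < n%:R -> s = (p^-1 - (fine (sobolev_conjugate n q))^-1)^-1 &
        forall Omega : set 'rV[R]_n, sobolev_extension_domain p q Omega ->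
        exists2 delta : R, 0 < delta &
        forall (x : 'rV[R]_n) (r : R),
          boundary Omega x -> 0 < r -> r <= diameter Omega / 6 ->
          ((delta * r `^ s)%:E
             <= lebesgue_rV n (euclidean_ball x r `&` Omega))%E].
Proof.
have n0 : (0 < n)%N by exact: ltnW.
have nR0 : 0 < n%:R :> R by rewrite ltr0n.
have q0 : 0 < q by rewrite (lt_le_trans ltr01).
have p0 : 0 < p by exact: lt_trans qp.
(* When q >= n any finite t > p is admissible; p + 1 depends on p alone and gives s = p (p + 1). *)
pose t : R := if q < n%:R then fine (sobolev_conjugate n q) else p + 1.
have pt : p < t.
  rewrite /t; move: pqs; rewrite /sobolev_conjugate; case: ifP => _ /=.
    by rewrite lte_fin.
  by rewrite ltrDl.
have t0 : 0 < t by exact: lt_trans pt.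
have tE : q < n%:R -> t = q * n%:R / (n%:R - q).
  by rewrite /t /sobolev_conjugate => ->.
have nqt : n%:R - q <= (t / q - 1)^-1 * q.
  have [qn|nq] := ltP q n%:R; last first.
    rewrite (@le_trans _ _ 0) ?subr_le0// mulr_ge0 ?invr_ge0 ?ltW// subr_gt0.
    by rewrite ltr_pdivlMr// mul1r (lt_trans qp).
  have nq0 : 0 < n%:R - q by rewrite subr_gt0.
  rewrite tE// le_eqVlt; apply/orP; left; apply/eqP; field.
  by rewrite !gt_eqF.
have s0 : 0 < p^-1 - t^-1 by rewrite subr_gt0 ltf_pV2.
exists (p^-1 - t^-1)^-1; split.
(* In terms of inverses: for q < n, 1/p - 1/t = 1/n - (1/q - 1/p) <= 1/n, and for q >= n already 1/p
   <= 1/n. *)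
- rewrite -[n%:R]invrK lef_pV2 ?posrE ?invr_gt0//.
  have [qn|nq] := ltP q n%:R.
    have nq0 : 0 < n%:R - q by rewrite subr_gt0.
    have -> : t^-1 = q^-1 - n%:R^-1.
      rewrite tE//; field.
      by rewrite !gt_eqF.
    rewrite opprB addrCA gerDl subr_le0 lef_pV2// ltW//.
  rewrite lerBlDr; apply: (@le_trans _ _ n%:R^-1).
    by rewrite lef_pV2 ?posrE// (le_trans nq)// ltW.
  by rewrite lerDl invr_ge0 ltW.
- by rewrite /t => ->.
move=> Omega ext; have [[_ oO _] _ _] := ext.
pose d := diameter Omega / 6.
have [M M0 decay] := extension_decay d n0 q1 qp pt nqt ext.
have kp : 1 < t / p by rewrite ltr_pdivlMr// mul1r.
have [delta delta0 lower] := lower_bound_of_decay M0 kp t0.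
have mO := open_measurable_rV oO.
(* Matches the exponent t/(kappa - 1) of the iteration with kappa = t/p. *)
have sE : (p^-1 - t^-1)^-1 = t / (t / p - 1).
  by field; rewrite mulN1r subr_eq0 !gt_eqF.
exists delta => // x r [xO _] r0 rd.
pose phi s := fine (lebesgue_rV n (euclidean_ball x s `&` Omega)).
have oball s : 0 < s -> open (euclidean_ball x s `&` Omega).
  by move=> s0'; apply: openI => //; exact: open_euclidean_ball.
have phiE s : 0 < s -> lebesgue_rV n (euclidean_ball x s `&` Omega) = (phi s)%:E.
  by move=> s0'; rewrite fineK// ge0_fin_numE// euclidean_ball_lty.
rewrite phiE// lee_fin sE; apply: (lower phi d) => // [s s0'|a b a0 ab|rho r' rho0 rhor rd'].
(* As x lies in the closure of Omega, every ball around it meets Omega in a nonempty open set, which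
   has positive measure. *)
- rewrite -lte_fin -phiE//.
  have nb : nbhs x (euclidean_ball x s).
    apply: open_nbhs_nbhs; split; first exact: open_euclidean_ball.
    rewrite euclidean_ballE//= subrr /sqnorm big1 ?exprn_gt0// => i _.
    by rewrite mxE expr0n.
  have [y [Oy xy]] := xO _ nb.
  by apply: (@open_measure_gt0 _ _ _ y); [exact: oball|].
- rewrite -lee_fin -!phiE//; last exact: lt_le_trans ab.
  apply: le_measure; rewrite ?inE.
  + by apply: open_measurable_rV; exact: oball.
  + by apply: open_measurable_rV; apply: oball; exact: lt_le_trans ab.
  + by apply: setSI => z /=; rewrite /euclidean_ball/= => /lt_le_trans; apply.
- exact: decay.
Qed.
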